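(* For degenerate Kundt metrics in dimension $n=4$, let $$I_1=\frac{(W_1)_v^2h_{22}-2(W_1)_v(W_2)_vh_{12}+(W_2)_v^2h_{11}}{h_{11}h_{22}-h_{12}^2},\qquad I_{2a}=H_{vv},\qquad I_{2b}=\frac{\left((W_1)_{x^2v}-(W_2)_{x^1v}\right)^2}{h_{11}h_{22}-h_{12}^2}.$$ Let $a_1,a_2$ be the solution of the equations $$(\hat dI_1+a_1\hat dI_{2a}+a_2\hat dI_{2b})(\mathcal{D}_{x^1})=0,\qquad (\hat dI_1+a_1\hat dI_{2a}+a_2\hat dI_{2b})(\mathcal{D}_{x^2})=0,$$ and set $$\nabla_1=g^{-1}(\hat dI_1+a_1\hat dI_{2a}+a_2\hat dI_{2b}),\qquad \nabla_2=g^{-1}\hat dI_{2a},\qquad \nabla_3=g^{-1}\hat dI_{2b},$$ and let $\nabla_4$ be determined by $$g(\nabla_1,\nabla_4)=1,\qquad g(\nabla_2,\nabla_4)=0,\qquad g(\nabla_3,\nabla_4)=0,\qquad g(\nabla_4,\nabla_4)=0 .$$ The derivations $\nabla_1,\nabla_2,\nabla_3,\nabla_4$ are invariant with respect to $\mathcal{G}$, and independent on a Zariski open subset of $\tilde{\mathcal{E}}^3$.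
   Context: Four-dimensional degenerate Kundt metrics in adapted coordinates $(u,x^1,x^2,v)$ are $g=du\,(dv+H\,du+W_1\,dx^1+W_2\,dx^2)+\sum_{i,j=1}^2h_{ij}\,dx^i\,dx^j$ with $H,W_i$ functions of $(u,x,v)$, $h_{ij}=h_{ji}$ functions of $(u,x)$, $(h_{ij})$ positive definite, and $(W_i)_{vv}=0$, $H_{vvv}=0$. Let $\pi$ be the trivial bundle over $\mathbb{R}^4(u,x^1,x^2,v)$ with fiber coordinates $H,W_1,W_2,h_{11},h_{12},h_{22}$ ($(h_{ij})$ positive definite). $\tilde{\mathcal{E}}^k\subset J^k\pi$ is given by those of the equations $(h_{ij})_v=0$, $(W_i)_{vv}=0$, $H_{vvv}=0$ and all their total derivatives that have order $\le k$; $\tilde{\mathcal{E}}^\infty$ is the infinite prolongation. $\mathcal{G}$ is the Lie pseudogroup of local diffeomorphisms $(u,x^i,v)\mapsto(C(u),A^i(u,x),v/C'(u)+B(u,x))$ with $\det[A^i_{x^j}]\neq0$, $C'\ne0$; it acts on Kundt metrics of the form $g=du\,(dv+H\,du+W_1\,dx^1+W_2\,dx^2)+\sum_{i,j=1}^2h_{ij}\,dx^i\,dx^j$, hence on $J^0\pi$ (so that $g$, viewed as a horizontal symmetric 2-form on $\pi$, is invariant), and the action prolongs to jets preserving $\tilde{\mathcal{E}}^k$. Subscripts on $H,W_i,h_{ij}$ denote jet variables; $\mathcal{D}_u,\mathcal{D}_{x^i},\mathcal{D}_v$ are the total derivatives; the horizontal differential is $\hat df=\mathcal{D}_u(f)du+\mathcal{D}_{x^i}(f)dx^i+\mathcal{D}_v(f)dv$;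 for a horizontal 1-form $\omega$, $g^{-1}\omega$ is the horizontal vector field $X$ with $g(X,\cdot)=\omega$. An invariant derivation is a horizontal vector field (combination of total derivatives with coefficients functions on some $\tilde{\mathcal{E}}^r$) invariant under the prolonged action of $\mathcal{G}$. ''Zariski open'' means nonempty Zariski open (in the fibers over $J^0\pi$). *)

(* Defs.v *)
(* [R : realType] plays the role of the real line. *)
From HB Require Import structures.
From mathcomp Require Import all_boot all_order all_algebra.
From mathcomp Require Import all_classical all_reals all_analysis.
From mathcomp Require mpoly.
Import Order.TTheory GRing.Theory Num.Theory.
Import numFieldNormedType.Exports.

Set Implicit Arguments.
Unset Strict Implicit.
Unset Printing Implicit Defensive.

Local Open Scope classical_set_scope.
Local Open Scope ring_scope.

(* Base coordinates (u, x^1, x^2, v) of R^4. *)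
Definition iu : 'I_4 := @Ordinal 4 0 isT.
Definition ix1 : 'I_4 := @Ordinal 4 1 isT.
Definition ix2 : 'I_4 := @Ordinal 4 2 isT.
Definition iv : 'I_4 := @Ordinal 4 3 isT.

(* Fiber coordinates (H, W_1, W_2, h_11, h_12, h_22) of the bundle pi. *)
Definition cH : 'I_6 := @Ordinal 6 0 isT.
Definition cW1 : 'I_6 := @Ordinal 6 1 isT.
Definition cW2 : 'I_6 := @Ordinal 6 2 isT.
Definition ch11 : 'I_6 := @Ordinal 6 3 isT.
Definition ch12 : 'I_6 := @Ordinal 6 4 isT.
Definition ch22 : 'I_6 := @Ordinal 6 5 isT.

Definition posdef (R : realType) (y : 'rV[R]_6) : Prop :=
  forall a b : R, (a != 0) || (b != 0) ->
    0 < y 0 ch11 * a ^+ 2 + 2 * y 0 ch12 * (a * b) + y 0 ch22 * b ^+ 2.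

(* g = du (dv + H du + W_1 dx^1 + W_2 dx^2) + sum_ij h_ij dx^i dx^j, where the
   product of 1-forms is the symmetric one, ab = (a (x) b + b (x) a) / 2; thus
   g(d_u, d_u) = H, g(d_u, d_v) = 1/2 and g(d_u, d_x^i) = W_i / 2. *)
Definition kundt (R : realType) (y : 'rV[R]_6) (X Y : 'rV[R]_4) : R :=
  let tau (Z : 'rV[R]_4) := Z 0 iv + y 0 cH * Z 0 iu
                            + y 0 cW1 * Z 0 ix1 + y 0 cW2 * Z 0 ix2 in
  (X 0 iu * tau Y + tau X * Y 0 iu) / 2
  + y 0 ch11 * X 0 ix1 * Y 0 ix1
  + y 0 ch12 * (X 0 ix1 * Y 0 ix2 + X 0 ix2 * Y 0 ix1)
  + y 0 ch22 * X 0 ix2 * Y 0 ix2.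

Definition partial (R : realType) (i : 'I_4) (f : 'rV[R]_4 -> R) :
  'rV[R]_4 -> R := fun z => 'D_(delta_mx 0 i : 'rV[R]_4) f z.

Definition partials (R : realType) (l : seq 'I_4) (f : 'rV[R]_4 -> R) :
  'rV[R]_4 -> R := foldr (@partial R) f l.

(* On an open set U this is being of class C^infinity. *)
Definition smooth_on (R : realType) (n : nat) (U : set 'rV[R]_4)
    (f : 'rV[R]_4 -> 'rV[R]_n) : Prop :=
  forall (a : 'I_n) (l : seq 'I_4) (z : 'rV[R]_4), U z ->
    differentiable (partials l (fun w => f w 0 a)) z.

(* A multi-index of order <= k, encoded as the nondecreasing word listing the
   directions of differentiation. *)
Definition midx (k : nat) :=
  {m : k.-bseq 'I_4 | sorted (fun i j : 'I_4 => (i <= j)%N) m}.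

Definition word (k : nat) (m : midx k) : seq 'I_4 := val (val m).

(* The vector space of which J^k pi is the open subset defined by [posdef]:
   base point and jet variables of order <= k. *)
Notation jet R k := ('rV[R]_4 * 'M[R]_(6, #|{: midx k}|))%type.

(* The jet variable u^a_l, for a word l in any order (0 if size l > k). *)
Definition jcoord (R : realType) (k : nat) (th : jet R k) (a : 'I_6)
    (l : seq 'I_4) : R :=
  if [pick m : midx k | perm_eq (word m) l] is Some m
  then th.2 a (enum_rank m) else 0.

Definition jetof (R : realType) (k : nat) (s : 'rV[R]_4 -> 'rV[R]_6)
    (p : 'rV[R]_4) : jet R k :=
  (p, \matrix_(a, j) partials (word (enum_val j)) (fun z => s z 0 a) p).

(* The projection J^(k+1) pi -> J^k pi. *)
Definition trunc (R : realType) (k : nat) (th : jet R k.+1) : jet R k :=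
  (th.1, \matrix_(a, j) jcoord th a (word (enum_val j))).

(* With [th.1], the projection to J^0 pi. *)
Definition jval (R : realType) (k : nat) (th : jet R k) : 'rV[R]_6 :=
  \row_a jcoord th a [::].

(* D_i = d/dx^i + sum_(a, l) u^a_(l + i) d/du^a_l as a tangent vector to J^k pi,
   depending on a point of J^(k+1) pi. *)
Definition Dvec (R : realType) (k : nat) (i : 'I_4) (th : jet R k.+1) :
  jet R k := (delta_mx 0 i, \matrix_(a, j) jcoord th a (i :: word (enum_val j))).

Definition Dtot (R : realType) (k : nat) (i : 'I_4) (f : jet R k -> R)
    (th : jet R k.+1) : R := 'D_(Dvec i th) f (trunc th).

(* The equations of order <= k; the total derivative D_l of the jet variable
   u^a_m is u^a_(l ++ m). *)
Definition Etilde (R : realType) (k : nat) (th : jet R k) : Prop :=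
  [/\ posdef (jval th),
      forall (c : 'I_6) (l : seq 'I_4), c \in [:: ch11; ch12; ch22] ->
        (size (l ++ [:: iv]) <= k)%N -> jcoord th c (l ++ [:: iv]) = 0,
      forall (c : 'I_6) (l : seq 'I_4), c \in [:: cW1; cW2] ->
        (size (l ++ [:: iv; iv]) <= k)%N -> jcoord th c (l ++ [:: iv; iv]) = 0
    & forall l : seq 'I_4,
        (size (l ++ [:: iv; iv; iv]) <= k)%N ->
        jcoord th cH (l ++ [:: iv; iv; iv]) = 0].

(* [phi], restricted to the open set U, belongs to the pseudogroup G.  Smoothness
   of phi on U amounts to that of C, A^i and B on the projections of U. *)
Definition pseudogroup (R : realType) (U : set 'rV[R]_4)
    (phi : 'rV[R]_4 -> 'rV[R]_4) : Prop :=
  [/\ open U, open (phi @` U), smooth_on U phi,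
      exists2 psi : 'rV[R]_4 -> 'rV[R]_4,
        smooth_on (phi @` U) psi & forall z, U z -> psi (phi z) = z
    & exists (C : R -> R) (A1 A2 B : R -> R -> R -> R),
      forall z, U z ->
        let u := z 0 iu in let x1 := z 0 ix1 in let x2 := z 0 ix2 in
        [/\ phi z 0 iu = C u,
            phi z 0 ix1 = A1 u x1 x2,
            phi z 0 ix2 = A2 u x1 x2,
            phi z 0 iv = z 0 iv / derive1 C u + B u x1 x2
          & derive1 C u != 0 /\
            derive1 (fun t => A1 u t x2) x1 * derive1 (fun t => A2 u x1 t) x2
            - derive1 (fun t => A1 u x1 t) x2 * derive1 (fun t => A2 u t x2) x1
            != 0]].

Definition section_on (R : realType) (U : set 'rV[R]_4)
    (s : 'rV[R]_4 -> 'rV[R]_6) : Prop :=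
  smooth_on U s /\ forall z, U z -> posdef (s z).

(* [phi] carries the metric given by s on U to the metric given by s' on phi(U),
   i.e. s = phi^* s'. *)
Definition carries (R : realType) (U : set 'rV[R]_4)
    (phi : 'rV[R]_4 -> 'rV[R]_4) (s s' : 'rV[R]_4 -> 'rV[R]_6) : Prop :=
  [/\ section_on U s, section_on (phi @` U) s'
    & forall z, U z -> forall X Y : 'rV[R]_4,
        kundt (s z) X Y = kundt (s' (phi z)) ('d phi z X) ('d phi z Y)].

(* A horizontal vector X at a jet is given by its coefficients on the total
   derivatives; this is its component tangent to J^k pi. *)
Definition hvec (R : realType) (k : nat) (X : 'rV[R]_4) (th : jet R k.+1) :
  jet R k := \sum_i X 0 i *: Dvec i th.

(* Invariance of a horizontal vector field X with coefficients defined on a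
   subset V of Etilde^3.  The prolongation phi^(k) sends j^k_z s to
   j^k_(phi z) s', where s' = phi . s; the horizontal vector X at the jet of s at
   p is tangent to the graph of j^k s, so that phi^(k) pushes it to the
   derivative at p, in the direction X, of phi^(k) \o j^k s = j^k s' \o phi. *)
Definition invariant_derivation (R : realType) (V : set (jet R 3))
    (X : jet R 3 -> 'rV[R]_4) : Prop :=
  forall (U : set 'rV[R]_4) (phi : 'rV[R]_4 -> 'rV[R]_4)
    (s s' : 'rV[R]_4 -> 'rV[R]_6) (p : 'rV[R]_4),
  pseudogroup U phi -> carries U phi s s' -> U p ->
  (forall k, Etilde (jetof k s p)) -> V (jetof 3 s p) ->
  V (jetof 3 s' (phi p)) /\
  forall k : nat,
    'D_(X (jetof 3 s p)) (fun z => jetof k s' (phi z)) p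
    = hvec (X (jetof 3 s' (phi p))) (jetof k.+1 s' (phi p)).

(* The invariants have order <= 2; all three are regarded as functions on
   J^2 pi. *)
Definition I1 (R : realType) (th : jet R 2) : R :=
  let h11 := jcoord th ch11 [::] in
  let h12 := jcoord th ch12 [::] in
  let h22 := jcoord th ch22 [::] in
  let W1v := jcoord th cW1 [:: iv] in
  let W2v := jcoord th cW2 [:: iv] in
  (W1v ^+ 2 * h22 - 2 * W1v * W2v * h12 + W2v ^+ 2 * h11)
  / (h11 * h22 - h12 ^+ 2).

Definition I2a (R : realType) (th : jet R 2) : R := jcoord th cH [:: iv; iv].

Definition I2b (R : realType) (th : jet R 2) : R :=
  let h11 := jcoord th ch11 [::] in
  let h12 := jcoord th ch12 [::] in
  let h22 := jcoord th ch22 [::] in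
  (jcoord th cW1 [:: ix2; iv] - jcoord th cW2 [:: ix1; iv]) ^+ 2
  / (h11 * h22 - h12 ^+ 2).

(* Horizontal 1-forms are given by their values on the total derivatives. *)
Definition hd (R : realType) (f : jet R 2 -> R) (th : jet R 3) : 'rV[R]_4 :=
  \row_i Dtot i f th.

(* The horizontal vector g^-1 w; the set is a singleton wherever h is positive
   definite. *)
Definition sharp (R : realType) (th : jet R 3) (w : 'rV[R]_4) : 'rV[R]_4 :=
  xget 0 [set X : 'rV[R]_4 |
    forall Y : 'rV[R]_4, kundt (jval th) X Y = \sum_i w 0 i * Y 0 i].

Definition form1 (R : realType) (th : jet R 3) (a : R * R) : 'rV[R]_4 :=
  hd (@I1 R) th + a.1 *: hd (@I2a R) th + a.2 *: hd (@I2b R) th.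

Definition a_solutions (R : realType) (th : jet R 3) : set (R * R) :=
  [set a | form1 th a 0 ix1 = 0 /\ form1 th a 0 ix2 = 0].

Definition a12 (R : realType) (th : jet R 3) : R * R :=
  xget (0, 0) (a_solutions th).

Definition nabla1 (R : realType) (th : jet R 3) : 'rV[R]_4 :=
  sharp th (form1 th (a12 th)).

Definition nabla2 (R : realType) (th : jet R 3) : 'rV[R]_4 :=
  sharp th (hd (@I2a R) th).

Definition nabla3 (R : realType) (th : jet R 3) : 'rV[R]_4 :=
  sharp th (hd (@I2b R) th).

Definition nabla4_solutions (R : realType) (th : jet R 3) : set 'rV[R]_4 :=
  [set X | [/\ kundt (jval th) (nabla1 th) X = 1,
               kundt (jval th) (nabla2 th) X = 0,
               kundt (jval th) (nabla3 th) X = 0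
             & kundt (jval th) X X = 0]].

Definition nabla4 (R : realType) (th : jet R 3) : 'rV[R]_4 :=
  xget 0 (nabla4_solutions th).

(* [nabla2] and [nabla3] are defined on all of Etilde^3; [nabla1] and [nabla4]
   are defined where the equations determine a_1, a_2, resp. also nabla_4. *)
Definition dom_nabla1 (R : realType) : set (jet R 3) :=
  [set th | Etilde th /\ exists! a, a_solutions th a].

Definition dom_nabla4 (R : realType) : set (jet R 3) :=
  [set th | dom_nabla1 th /\ exists! X, nabla4_solutions th X].

(* V is a subset of Etilde^k whose trace on every fiber of
   Etilde^k -> J^0 pi is nonempty and Zariski open, i.e. is the complement of
   the common zeros of a set S of polynomials in the jet variables. *)
Definition zariski_open (R : realType) (k : nat) (V : set (jet R k)) : Prop :=
  (V `<=` [set th | Etilde th]) /\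
  forall (p : 'rV[R]_4) (y : 'rV[R]_6), posdef y ->
    let fiber := [set th : jet R k | [/\ Etilde th, th.1 = p & jval th = y]] in
    (V `&` fiber !=set0) /\
    exists S : set (mpoly.mpoly (6 * #|{: midx k}|) R),
      forall th, fiber th ->
        (V th <-> exists2 P, S P & mpoly.meval (mxvec th.2 0) P != 0).

(* Main.v *)
(* Write G_ab for the coefficients of the metric of a section s, and G'_ab for
   those of its image s' under a map phi of the pseudogroup.  The Jacobian J of
   phi satisfies d_v phi = e d_v and d_(x^i) phi_u = 0, so differentiating
   G_ab = G'_cd(phi) J_a^c J_b^d along v gives
     d_v^n G_ab = e^n (d_v^n G'_cd)(phi) J_a^c J_b^d,
   up to one extra term when n = 1 and a = b = u.  The Kundt equations say that
   1 + #{u in ab} v-derivatives annihilate G_ab, so they are preserved.  They are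
   known only to infinite order at one point p, whence I(s) and I(s')(phi) agree,
   for each of the three invariants I, up to a function all of whose derivatives
   vanish at p.  Therefore the forms dI are invariant.  They have no dv component,
   so the equations for a_1, a_2 are multiplied by an invertible 2 x 2 matrix, and
   the dual vectors are transported by d phi.
   Independence: where the 2 x 2 minor (x^1, x^2) of dI_2a, dI_2b and the 3 x 3
   minor (u, x^1, x^2) of dI_1, dI_2a, dI_2b are nonzero, the form dual to nabla_1
   is a nonzero multiple of du, so nabla_1 is null and orthogonal to nabla_2 and
   nabla_3; pairing a linear relation first with nabla_4, then with nabla_1,
   and then with d_(x^1) and d_(x^2) kills its coefficients. *)

From HB Require Import structures.
Require Import Defs.
From mathcomp Require Import all_boot all_order all_algebra.
From mathcomp Require Import all_classical all_reals all_analysis.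
From mathcomp Require Import ring lra.
From mathcomp Require mpoly.
Import Order.TTheory GRing.Theory Num.Theory.
Import numFieldNormedType.Exports.
Import (canonicals) mpoly.

Set Implicit Arguments.
Unset Strict Implicit.
Unset Printing Implicit Defensive.

Local Open Scope classical_set_scope.
Local Open Scope ring_scope.

(** * Symmetry of second derivatives *)

(** The law for v-derivatives expresses the coefficients of s through those of s', whereas the Kundt
    equations are given for s. They reach s' through the same law for the inverse map. For this
    reason [kmap] retains from the normal form of a map only the zero pattern of its Jacobian,
    together with the law for G_ab: the inverse satisfies these without being written with functions
    C, A^i and B.

    Away from p the equations may fail, and with them the identities behind the invariants. These
    are therefore computed modulo functions flat at p, an ideal stable under composition with phi
    and under partial derivatives; the curl of W_v relies on the latter.

    Zariski openness rests on h being constant along a fiber over J^0: the denominators det h are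
    nonzero constants there, so the product of the two minors is a polynomial in the jet variables.
    A jet written down over every positive definite h shows that it vanishes identically on no
    fiber. *)

Lemma differentiable_expansion (R : realType) (V W : normedModType R) (f : V -> W) (z : V)
    (e : R) :
  differentiable f z -> 0 < e ->
  exists2 d : R, 0 < d &
    forall w, `|w| < d -> `|f (z + w) - f z - 'd f z w| <= e * `|w|.
Proof.
move=> df e0.
have /diff_locallyP[_ E] := df.
have /eqaddoP/(_ e e0) : f \o shift z = cst (f z) + 'd f z +o_ 0 id by [].
move=> /nbhs_normP[d /= d0 H]; exists d => // w wd.
have /= := H w; rewrite /ball_ /= sub0r normrN => /(_ wd).
rewrite !fctE /= /cst [w + z]addrC; by rewrite opprD addrA.
Qed.

Lemma segment_derive (R : realType) (V : normedModType R) (f : V -> R) (z a w : V) (t : R) :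
  differentiable f (z + w + t *: a) ->
  is_derive t 1 (fun t : R => f (z + w + t *: a)) ('D_a f (z + w + t *: a)).
Proof.
move=> df; set g := fun t : R => z + w + t *: a.
have dg : is_diff t g ( *:%R ^~ a).
  rewrite [X in is_diff _ _ X](_ : _ = 0 + *:%R ^~ a); last by rewrite add0r.
  exact: is_diffD.
have dc : differentiable (f \o g) t by apply: differentiable_comp.
apply: DeriveDef; first exact: diff_derivable.
by rewrite (deriveE _ dc) diff_comp //= (deriveE _ df) (@diff_val _ _ _ _ _ g _ dg) scale1r.
Qed.

(* The mean value theorem applied to [t |-> f (z + h b + t a) - f (z + t a)]. *)
Lemma second_difference (R : realType) (V : normedModType R) (f : V -> R) (z a b : V) (e : R) :
  (\forall w \near z, differentiable f w) -> differentiable ('D_a f) z -> 0 < e ->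
  \forall h \near (0 : R)^'+,
    `|f (z + h *: b + h *: a) - f (z + h *: b) - f (z + h *: a) + f z
      - h ^+ 2 * 'D_b ('D_a f) z| <= e * h ^+ 2.
Proof.
move=> nf dF e0.
(* [h * k] bounds the norms of [h *: b + c *: a] and [c *: a] together, so two expansions with
   relative error [e / k] contribute at most [e * h]; the other factor [h] comes from the mean value
   theorem. The summand 1 keeps [k] positive. *)
pose k := 2 * `|a| + `|b| + 1.
have k0 : 0 < k by rewrite ltr_wpDl // addr_ge0 // mulr_ge0.
have ek0 : 0 < e / k by rewrite divr_gt0.
have [d d0 Hd] := differentiable_expansion dF ek0.
have /nbhs_normP[r /= r0 Hr] := nf.
pose m := Num.min d r.
have m0 : 0 < m by rewrite lt_min d0 r0.
near=> h.
have h0 : 0 < h by near: h; exact: nbhs_right_gt.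
have hm : h < m / k by near: h; apply: nbhs_right_lt; rewrite divr_gt0.
have hkm : h * k < m by rewrite -ltr_pdivlMr.
have bound (t s : R) : 0 <= t <= h -> 0 <= s <= h -> `|s *: b + t *: a| < m.
  move=> /andP[t0 th] /andP[s0 sh]; apply: le_lt_trans hkm.
  rewrite (le_trans (ler_normD _ _)) // !normrZ (ger0_norm t0) (ger0_norm s0).
  have := normr_ge0 a; have := normr_ge0 b; rewrite /k; nra.
have Df (t s : R) : 0 <= t <= h -> 0 <= s <= h -> differentiable f (z + s *: b + t *: a).
  move=> th sh; apply: Hr => /=; rewrite -addrA opprD addrA subrr add0r normrN.
  by rewrite (lt_le_trans (bound _ _ th sh)) // ge_min lexx orbT.
have hh : 0 <= h <= h by rewrite lexx ltW.
have zh : 0 <= (0 : R) <= h by rewrite lexx ltW.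
pose g (t : R) : R := f (z + h *: b + t *: a) - f (z + 0 *: b + t *: a).
have dg (t : R) : 0 <= t <= h ->
    is_derive t 1 g ('D_a f (z + h *: b + t *: a) - 'D_a f (z + 0 *: b + t *: a)).
  by move=> th; apply: is_deriveB; apply: segment_derive; apply: Df.
have gc : {within `[0, h], continuous g}.
  apply: derivable_within_continuous => t; rewrite in_itv /= => th.
  by case: (dg _ th).
have [|c] := @MVT R g (fun t => 'D_a f (z + h *: b + t *: a) - 'D_a f (z + 0 *: b + t *: a))
    0 h h0 _ gc.
  by move=> t; rewrite in_itv /= => /andP[t0 th]; apply: dg; rewrite (ltW t0) (ltW th).
rewrite in_itv /= => /andP[/ltW c0 /ltW ch].
have cc : 0 <= c <= h by rewrite c0 ch.
rewrite subr0 /g !scale0r !addr0 => Eg.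
have E1 := Hd (h *: b + c *: a).
have E2 := Hd (c *: a).
have /E1 {}E1 : `|h *: b + c *: a| < d.
  by rewrite (lt_le_trans (bound _ _ cc hh)) // ge_min lexx.
have /E2 {}E2 : `|c *: a| < d.
  have := bound _ _ cc zh; rewrite scale0r add0r => bb.
  by rewrite (lt_le_trans bb) // ge_min lexx.
rewrite (deriveE _ dF).
have -> : f (z + h *: b + h *: a) - f (z + h *: b) - f (z + h *: a) + f z =
   ('D_a f (z + h *: b + c *: a) - 'D_a f (z + c *: a)) * h.
  rewrite -Eg; ring.
have La1 : 'd ('D_a f) z (c *: a) = c * 'd ('D_a f) z a by rewrite linearZ.
have Lb1 : 'd ('D_a f) z (h *: b + c *: a) = h * 'd ('D_a f) z b + c * 'd ('D_a f) z a.
  by rewrite linearD !linearZ.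
move: E1 E2; rewrite La1 Lb1 [z + (_ + _)]addrA.
set Fhc := 'D_a f (z + h *: b + c *: a); set Fc := 'D_a f (z + c *: a).
set F0 := 'D_a f z; set La := 'd _ z a; set Lb := 'd _ z b.
move=> E1 E2.
have -> : (Fhc - Fc) * h - h ^+ 2 * Lb =
  h * ((Fhc - F0 - (h * Lb + c * La)) - (Fc - F0 - c * La)) by ring.
rewrite normrM (ger0_norm (ltW h0)).
have E3 : `|h *: b + c *: a| + `|c *: a| <= h * k.
  rewrite (le_trans (lerD (ler_normD _ _) (lexx _))) // !normrZ (ger0_norm c0) (ger0_norm (ltW h0)).
  have := normr_ge0 a; have := normr_ge0 b; rewrite /k; nra.
have E4 : `|Fhc - F0 - (h * Lb + c * La) - (Fc - F0 - c * La)| <= e * h.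
  rewrite (le_trans (ler_normB _ _)) // (le_trans (lerD E1 E2)) // -mulrDr.
  rewrite (le_trans (ler_wpM2l (ltW ek0) E3)) //.
  by rewrite -mulrA [h * k]mulrC mulKf // gt_eqF.
have := ler_wpM2l (ltW h0) E4.
by rewrite mulrCA expr2.
Unshelve. all: by end_near.
Qed.

(** Young's form of the symmetry theorem: the second difference is symmetric in [a] and [b], and
    [h ^+ 2] times either iterated derivative lies within [e / 2 * h ^+ 2] of it. *)
Lemma derive_comm (R : realType) (V : normedModType R) (f : V -> R) (z a b : V) :
  (\forall w \near z, differentiable f w) ->
  differentiable ('D_a f) z -> differentiable ('D_b f) z ->
  'D_b ('D_a f) z = 'D_a ('D_b f) z.
Proof.
move=> nf da db; apply/eqP; rewrite -subr_eq0 -normr_le0; apply/ler_addgt0Pr => e e0; rewrite add0r.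
have e20 : 0 < e / 2 by rewrite divr_gt0.
have Fa := second_difference b nf da e20.
have Fb := second_difference a nf db e20.
(* One [h] serves both estimates, because the right neighbourhoods of 0 form a proper filter. *)
have : exists h : R, [/\ 0 < h,
  `|f (z + h *: b + h *: a) - f (z + h *: b) - f (z + h *: a) + f z
      - h ^+ 2 * 'D_b ('D_a f) z| <= e / 2 * h ^+ 2 &
  `|f (z + h *: a + h *: b) - f (z + h *: a) - f (z + h *: b) + f z
      - h ^+ 2 * 'D_a ('D_b f) z| <= e / 2 * h ^+ 2].
  apply/not_existsP => Hn.
  have FF : \forall h \near (0 : R)^'+, False.
    near=> h; apply: (Hn h); split; first by near: h; exact: nbhs_right_gt.
      exact: (near Fa h).
    exact: (near Fb h).
  exact: (@filter_not_empty _ ((0 : R)^'+)).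
move=> [h [h0 A B]].
rewrite (addrAC z) -[X in X + f z]addrA [- f (z + h *: a) - _]addrC addrA in B.
set S := f _ - _ - _ + _ in A B.
set x := 'D_b _ _ in A *; set y := 'D_a _ _ in B *.
have h20 : 0 < h ^+ 2 by rewrite exprn_gt0.
rewrite -(ler_pM2l h20) -[X in X * `|_|]ger0_norm; last exact: ltW.
rewrite -normrM.
have -> : h ^+ 2 * (x - y) = (S - h ^+ 2 * y) - (S - h ^+ 2 * x) by ring.
rewrite (le_trans (ler_normB _ _)) // (le_trans (lerD B A)) //.
by rewrite -mulrDl -splitr mulrC.
Unshelve. all: by end_near.
Qed.

(** * Smooth functions on an open set *)

(** [g] inherits the little-o expansion of [f] at [z], and uniqueness of the differential turns
    ['d f z] into ['d g z]. *)
Lemma differentiable_near (R : realType) (V W : normedModType R) (f g : V -> W) (z : V) :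
  (\forall w \near z, f w = g w) -> differentiable f z -> differentiable g z.
Proof.
move=> fg df; have [dc /eqaddoP E] := (diff_locallyP _ _).1 df.
have G : g \o shift z = cst (g z) + 'd f z +o_ 0 id.
  have fg0 : \forall w \near (0 : V), f (w + z) = g (w + z).
    have /nbhs_normP[r r0 Hr] := fg; apply/nbhs_normP; exists r => // w /= wr.
    by apply: Hr; rewrite /= opprD addrCA subrr addr0 normrN -normrN -sub0r.
  apply/eqaddoP => e e0; apply: filterS2 fg0 (E e e0) => w fgw.
  by rewrite !fctE /= /cst fgw (nbhs_singleton fg).
have D := diff_unique dc G.
by apply/diff_locallyP; rewrite D.
Qed.

Lemma differentiable_mx (R : realType) (V : normedModType R) (m n : nat)
    (M : V -> 'M[R]_(m, n)) (z : V) :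
  (forall i j, differentiable (fun w => M w i j : R) z) -> differentiable M z.
Proof.
move=> dM.
have -> : M = \sum_i \sum_j (fun w => M w i j *: delta_mx i j).
  apply/funext => w; rewrite [LHS]matrix_sum_delta fct_sumE.
  by apply: eq_bigr => i _; rewrite fct_sumE.
apply: differentiable_sum => i; apply: differentiable_sum => j.
exact: differentiableZl.
Qed.

Lemma derive_mxE (R : realType) (V : normedModType R) (m n : nat)
    (M : V -> 'M[R]_(m, n)) (z v : V) :
  (forall i j, differentiable (fun w => M w i j : R) z) ->
  'D_v M z = \matrix_(i, j) 'D_v (fun w => M w i j) z.
Proof. by move=> dM; apply/derive_mx/diff_derivable/differentiable_mx. Qed.

Section SmoothFunctions.
Context {R : realType}.
Implicit Types (U : set 'rV[R]_4) (f g : 'rV[R]_4 -> R) (z : 'rV[R]_4).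
Implicit Types (i j : 'I_4) (l : seq 'I_4).

(** A proof of [smooth_on], applied to an index, is a proof of [smooth] for that component. *)
Definition smooth U f := forall l z, U z -> differentiable (partials l f) z.

Lemma derive_partial f z (v : 'rV[R]_4) :
  differentiable f z -> 'D_v f z = \sum_i v 0 i * partial i f z.
Proof.
move=> df; rewrite deriveE // {1}[v]row_sum_delta linear_sum.
by apply: eq_bigr => i _; rewrite linearZ /partial deriveE.
Qed.

Lemma partial_eq U f g i z :
  open U -> (forall w, U w -> f w = g w) -> U z -> partial i f z = partial i g z.
Proof.
move=> oU fg Uz; apply: near_eq_derive.
by apply: filterS (open_nbhs_nbhs (conj oU Uz)) => w; apply: fg.
Qed.

Lemma partials_eq U f g l z :
  open U -> (forall w, U w -> f w = g w) -> U z -> partials l f z = partials l g z.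
Proof.
move=> oU fg; elim: l z => [|i l IH] z Uz /=; first exact: fg.
exact: (partial_eq i oU IH Uz).
Qed.

Lemma smooth_eq U f g :
  open U -> (forall w, U w -> f w = g w) -> smooth U f -> smooth U g.
Proof.
move=> oU fg sf l z Uz; apply: differentiable_near (sf l z Uz).
by apply: filterS (open_nbhs_nbhs (conj oU Uz)) => w; apply: partials_eq.
Qed.

Lemma partials_partial l i f : partials l (partial i f) = partials (rcons l i) f.
Proof. by rewrite /partials foldr_rcons. Qed.

Lemma smooth_partial U f i : smooth U f -> smooth U (partial i f).
Proof. by move=> sf l z Uz; rewrite partials_partial; apply: sf. Qed.

Lemma smooth_partials U f l : smooth U f -> smooth U (partials l f).
Proof. by move=> sf; elim: l => [|i l IH] //=; apply: smooth_partial. Qed.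

Lemma smooth_diff U f z : smooth U f -> U z -> differentiable f z.
Proof. by move=> sf; apply: (sf [::]). Qed.

Lemma partial_comm U f i j z :
  open U -> smooth U f -> U z -> partial i (partial j f) z = partial j (partial i f) z.
Proof.
move=> oU sf Uz; apply: derive_comm; last 2 first.
- exact: (sf [:: j]).
- exact: (sf [:: i]).
by apply: filterS (open_nbhs_nbhs (conj oU Uz)) => w; apply: smooth_diff.
Qed.

(** The head of [l1] is moved to the front of [l2] by successive swaps. The induction runs over all
    points of [U], since the equality obtained is differentiated again. *)
Lemma partials_perm U f l1 l2 z :
  open U -> smooth U f -> perm_eq l1 l2 -> U z -> partials l1 f z = partials l2 f z.
Proof.
move=> oU sf p Uz; elim: l1 l2 p z Uz => [|i l1 IH] l2 p z Uz.
  by rewrite perm_sym in p; rewrite (perm_nilP p).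
have il2 : i \in l2 by rewrite -(perm_mem p) mem_head.
case/splitPr: il2 p => l2a l2b p.
have {}p : perm_eq l1 (l2a ++ l2b).
  by rewrite -(perm_cons i) (perm_trans p) // -cat1s perm_catCA.
rewrite /= (partial_eq i oU (IH _ p) Uz).
elim: l2a z Uz {p} => [|j l2a IHa] z Uz //=.
rewrite (partial_comm _ _ oU (smooth_partials _ sf) Uz).
exact: (partial_eq j oU IHa Uz).
Qed.

Lemma partialD f g i z : differentiable f z -> differentiable g z ->
  partial i (fun w => f w + g w) z = partial i f z + partial i g z.
Proof. by move=> df dg; apply: deriveD; apply: diff_derivable. Qed.

Lemma partialM f g i z : differentiable f z -> differentiable g z ->
  partial i (fun w => f w * g w) z = partial i f z * g z + f z * partial i g z.
Proof.
move=> df dg; rewrite [LHS]deriveM; [|exact: diff_derivable..].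
by rewrite addrC [_ *: _]mulrC.
Qed.

Lemma partial_cst (c : R) i z : partial i (fun=> c) z = 0.
Proof. exact: derive_cst. Qed.

Lemma partial_comp f (phi : 'rV[R]_4 -> 'rV[R]_4) i z :
  (forall j, differentiable (fun w => phi w 0 j) z) -> differentiable f (phi z) ->
  partial i (f \o phi) z =
    \sum_j partial j f (phi z) * partial i (fun w => phi w 0 j) z.
Proof.
move=> dp df.
have dphi : differentiable phi z by apply: differentiable_mx => k j; rewrite ord1.
rewrite /partial deriveE; last exact: differentiable_comp.
rewrite diff_comp //= -deriveE // -(deriveE _ dphi) derive_partial //.
apply: eq_bigr => j _; rewrite mulrC; congr (_ * _).
by rewrite derive_mxE ?mxE // => k j'; rewrite ord1.
Qed.

(* Recursion on the order makes closure under products and composition provable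
   by induction, which [smooth], quantified over words, does not. *)
Fixpoint Ck (n : nat) U f : Prop :=
  if n is n'.+1 then (forall z, U z -> differentiable f z) /\ forall i, Ck n' U (partial i f)
  else forall z, U z -> differentiable f z.

(** [Ck] peels off the derivative applied first, which is the last letter of the word; hence the
    induction from the right. *)
Lemma smoothP U f : smooth U f <-> forall n, Ck n U f.
Proof.
split=> [sf n|Cf l].
  elim: n f sf => [|n IH] f sf /=; first by move=> z; apply: smooth_diff.
  split=> [z|i]; first exact: smooth_diff.
  exact/IH/smooth_partial.
move: l f Cf; elim/last_ind => [|l i IH] f Cf z Uz; first exact: (Cf 0%N).
rewrite -partials_partial; apply: IH => // n.
by case: (Cf n.+1) => _; exact.
Qed.

Lemma CkS n U f : Ck n.+1 U f -> Ck n U f.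
Proof.
elim: n f => [|n IH] f /=; first by case.
by move=> [df Cf]; split=> // i; apply: IH (Cf i).
Qed.

Lemma Ck_eq n U f g : open U -> (forall w, U w -> f w = g w) -> Ck n U f -> Ck n U g.
Proof.
move=> oU; elim: n f g => [|n IH] f g fg.
  move=> df z Uz; apply: differentiable_near (df z Uz).
  by apply: filterS (open_nbhs_nbhs (conj oU Uz)) => w; apply: fg.
move=> /= [df Cf]; split=> [z Uz|i].
  apply: differentiable_near (df z Uz).
  by apply: filterS (open_nbhs_nbhs (conj oU Uz)) => w; apply: fg.
by apply: IH (Cf i) => w Uw; apply: partial_eq Uw.
Qed.

Lemma CkD n U f g : open U -> Ck n U f -> Ck n U g -> Ck n U (fun w => f w + g w).
Proof.
move=> oU; elim: n f g => [|n IH] f g; first by move=> df dg z Uz; apply: differentiableD; auto.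
move=> /= [df Cf] [dg Cg]; split=> [z Uz|i]; first by apply: differentiableD; auto.
by apply: Ck_eq (IH _ _ (Cf i) (Cg i)) => // w Uw; rewrite partialD //; auto.
Qed.

Lemma CkM n U f g : open U -> Ck n U f -> Ck n U g -> Ck n U (fun w => f w * g w).
Proof.
move=> oU; elim: n f g => [|n IH] f g; first by move=> df dg z Uz; apply: differentiableM; auto.
move=> Cf Cg; have [df Cf'] := Cf; have [dg Cg'] := Cg.
split=> [z Uz|i]; first by apply: differentiableM; auto.
apply: Ck_eq (CkD oU (IH _ _ (Cf' i) (CkS Cg)) (IH _ _ (CkS Cf) (Cg' i))) => // w Uw.
by rewrite partialM //; auto.
Qed.

Lemma Ck_cst n U (c : R) : Ck n U (fun=> c).
Proof.
elim: n c => [|n IH] c /=; first by move=> z _; apply: differentiable_cst.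
split=> [z _|i]; first exact: differentiable_cst.
by rewrite (_ : partial i _ = fun=> 0); last by apply/funext => z; rewrite partial_cst.
Qed.

Lemma Ck_sum n U (I : Type) (r : seq I) (F : I -> 'rV[R]_4 -> R) :
  open U -> (forall k, Ck n U (F k)) -> Ck n U (fun w => \sum_(k <- r) F k w).
Proof.
move=> oU CF; elim: r => [|k r IH].
  by apply: Ck_eq (Ck_cst n U 0) => // w _; rewrite big_nil.
by apply: Ck_eq (CkD oU (CF k) IH) => // w _; rewrite big_cons.
Qed.

(** By the chain rule, a partial derivative of the composite is a sum of pulled back partial
    derivatives of [f] times Jacobian entries of [phi], so [CkM] closes the induction. *)
Lemma Ck_comp n U U' (phi : 'rV[R]_4 -> 'rV[R]_4) f :
  open U -> (forall z, U z -> U' (phi z)) -> smooth_on U phi -> Ck n U' f ->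
  Ck n U (f \o phi).
Proof.
move=> oU UU' sphi.
have dphi z : U z -> differentiable phi z.
  by move=> Uz; apply: differentiable_mx => k j; rewrite ord1; apply: (sphi j [::]).
elim: n f => [|n IH] f.
  by move=> df z Uz; apply: differentiable_comp; auto.
move=> Cf; have [df Cf'] := Cf.
split=> [z Uz|i]; first by apply: differentiable_comp; auto.
apply: (@Ck_eq _ U (fun w => \sum_j (partial j f \o phi) w * partial i (fun w => phi w 0 j) w)) => //.
  move=> w Uw; rewrite partial_comp //; last by apply: df; apply: UU'.
  by move=> j; apply: (sphi j [::]).
apply: Ck_sum => // j; apply: CkM => //; first exact: IH (Cf' j).
have /smoothP Cp : smooth U (partial i (fun w => phi w 0 j)) := smooth_partial i (sphi j); exact: Cp.
Qed.

Lemma smoothD U f g : open U -> smooth U f -> smooth U g -> smooth U (fun w => f w + g w).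
Proof. by move=> oU /smoothP Cf /smoothP Cg; apply/smoothP => n; apply: CkD. Qed.

Lemma smoothM U f g : open U -> smooth U f -> smooth U g -> smooth U (fun w => f w * g w).
Proof. by move=> oU /smoothP Cf /smoothP Cg; apply/smoothP => n; apply: CkM. Qed.

Lemma smooth_cst U (c : R) : smooth U (fun=> c).
Proof. by apply/smoothP => n; apply: Ck_cst. Qed.

Lemma smooth_sum U (I : Type) (r : seq I) (F : I -> 'rV[R]_4 -> R) :
  open U -> (forall k, smooth U (F k)) -> smooth U (fun w => \sum_(k <- r) F k w).
Proof. by move=> oU sF; apply/smoothP => n; apply: Ck_sum => // k; move/smoothP: (sF k). Qed.

Lemma smooth_comp U U' (phi : 'rV[R]_4 -> 'rV[R]_4) f :
  open U -> (forall z, U z -> U' (phi z)) -> smooth_on U phi -> smooth U' f ->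
  smooth U (f \o phi).
Proof. by move=> oU UU' sp /smoothP Cf; apply/smoothP => n; apply: Ck_comp UU' sp (Cf n). Qed.

End SmoothFunctions.

(** * Jet coordinates *)

Section JetCoordinates.
Context {R : realType}.
Implicit Types (k : nat) (a : 'I_6) (i : 'I_4) (l : seq 'I_4).

Notation leo := (fun i j : 'I_4 => (i <= j)%N).

Lemma word_size k (m : midx k) : (size (word m) <= k)%N.
Proof. exact: size_bseq. Qed.

(** Makes the choice in [jcoord] unambiguous: each class of words up to permutation contains a
    single nondecreasing one. *)
Lemma word_perm_inj k (m1 m2 : midx k) : perm_eq (word m1) (word m2) -> m1 = m2.
Proof.
move=> p; apply/val_inj/val_inj.
apply: (@sorted_eq _ leo) p.
- by move=> x y z; apply: leq_trans.
- by move=> x y; rewrite -eqn_leq => /eqP/val_inj.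
- exact: (valP m1).
- exact: (valP m2).
Qed.

Lemma word_sort k l : (size l <= k)%N -> exists m : midx k, perm_eq (word m) l.
Proof.
move=> sl; have ss : (size (sort leo l) <= k)%N by rewrite size_sort.
have so : sorted leo (Bseq ss) by apply: sort_sorted => x y; apply: leq_total.
by exists (exist _ (Bseq ss) so); rewrite /word /= perm_sort.
Qed.

Lemma jcoord_word k (th : jet R k) a l (m : midx k) :
  perm_eq (word m) l -> jcoord th a l = th.2 a (enum_rank m).
Proof.
move=> p; rewrite /jcoord; case: pickP => [m' p'|/(_ m)]; last by rewrite p.
by rewrite (@word_perm_inj _ m' m) // (perm_trans p') // perm_sym.
Qed.

Lemma jcoord_oversize k (th : jet R k) a l : (k < size l)%N -> jcoord th a l = 0.
Proof.
move=> kl; rewrite /jcoord; case: pickP => [m /perm_size E|//].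
by move: kl; rewrite -E ltnNge word_size.
Qed.

Lemma jcoord_perm k (th : jet R k) a l1 l2 :
  perm_eq l1 l2 -> jcoord th a l1 = jcoord th a l2.
Proof.
move=> p; case: (leqP (size l1) k) => s1.
  have [m pm] := word_sort s1.
  by rewrite (jcoord_word _ _ pm) (@jcoord_word _ _ _ l2 m) // (perm_trans pm).
by rewrite !jcoord_oversize // -(perm_size p).
Qed.

(** The matrices in [jetof], [trunc] and [Dvec] all have this shape, with [F] symmetric in the
    letters of the word. *)
Lemma jcoord_mk k (p : 'rV[R]_4) (F : 'I_6 -> seq 'I_4 -> R) a l :
  (forall l1 l2, perm_eq l1 l2 -> (size l1 <= k)%N -> F a l1 = F a l2) -> (size l <= k)%N ->
  jcoord ((p, \matrix_(b, j) F b (word (enum_val j))) : jet R k) a l = F a l.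
Proof.
move=> Fp sl; have [m pm] := word_sort sl.
by rewrite (jcoord_word _ _ pm) mxE enum_rankK; apply: Fp; rewrite // word_size.
Qed.

Lemma jet_ext k (th th' : jet R k) :
  th.1 = th'.1 -> (forall a l, (size l <= k)%N -> jcoord th a l = jcoord th' a l) -> th = th'.
Proof.
case: th th' => [p A] [p' A'] /= -> H; congr (_, _); apply/matrixP => a j.
have := H a _ (word_size (enum_val j)).
by rewrite !(jcoord_word _ _ (perm_refl _)) /= enum_valK.
Qed.

Lemma jcoord_trunc k (th : jet R k.+1) a l :
  (size l <= k)%N -> jcoord (trunc th) a l = jcoord th a l.
Proof.
by move=> sl; rewrite /trunc (jcoord_mk _ (F := fun a => jcoord th a)) // => l1 l2 p _; apply: jcoord_perm.
Qed.

Lemma jcoord_Dvec k (th : jet R k.+1) i a l :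
  (size l <= k)%N -> jcoord (Dvec i th) a l = jcoord th a (i :: l).
Proof.
move=> sl; rewrite /Dvec (jcoord_mk _ (F := fun a l => jcoord th a (i :: l))) // => l1 l2 p _.
by apply: jcoord_perm; rewrite perm_cons.
Qed.

Lemma jcoord_linear k a l : linear (fun th : jet R k => jcoord th a l : R^o).
Proof.
move=> c x y; rewrite /jcoord; case: pickP => [m _|_]; first by rewrite !mxE.
by rewrite scaler0 addr0.
Qed.

Lemma jcoord_continuous k a l : continuous (fun th : jet R k => jcoord th a l : R^o).
Proof.
rewrite /jcoord; case: pickP => [m _|_]; last by move=> x; exact: cvg_cst.
move=> x; apply: (@continuous_comp _ _ _ snd (fun M : 'M[R]_(6, _) => M a (enum_rank m))).
  exact: cvg_snd.
exact: coord_continuous.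
Qed.

Lemma jcoord_diff k a l (th : jet R k) :
  is_diff th (fun th : jet R k => jcoord th a l) (fun v : jet R k => jcoord v a l).
Proof.
pose f : {linear jet R k -> R^o} := HB.pack (fun th : jet R k => jcoord th a l : R^o)
  (GRing.isLinear.Build _ _ _ _ _ (@jcoord_linear k a l)).
apply: DiffDef; first exact: (@linear_differentiable _ _ _ f th (@jcoord_continuous k a l)).
exact: (@diff_lin _ _ _ f th (@jcoord_continuous k a l)).
Qed.

Lemma jcoord_is_derive k a l (th v : jet R k) :
  is_derive th v (fun th : jet R k => jcoord th a l) (jcoord v a l).
Proof.
have := jcoord_diff a l th => D; apply: DeriveDef; first exact/diff_derivable.
by rewrite deriveE // diff_val.
Qed.

Section Sections.
Context (U : set 'rV[R]_4) (s : 'rV[R]_4 -> 'rV[R]_6) (oU : open U) (sU : smooth_on U s).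

Lemma jcoord_jetof k z a l : U z -> (size l <= k)%N ->
  jcoord (jetof k s z) a l = partials l (fun w => s w 0 a) z.
Proof.
move=> Uz sl; rewrite /jetof (jcoord_mk _ (F := fun a l => partials l (fun w => s w 0 a) z)) // => l1 l2 p _.
exact: (partials_perm oU (sU a) p Uz).
Qed.

Lemma jval_jetof k z : U z -> jval (jetof k s z) = s z.
Proof. by move=> Uz; apply/rowP => a; rewrite mxE jcoord_jetof. Qed.

Lemma trunc_jetof k z : U z -> trunc (jetof k.+1 s z) = jetof k s z.
Proof.
move=> Uz; apply: jet_ext => // a l sl.
by rewrite jcoord_trunc // !jcoord_jetof // ltnW.
Qed.

Lemma jetof_differentiable k z : U z -> differentiable (jetof k s) z.
Proof.
move=> Uz; apply: differentiable_pair => //; apply: differentiable_mx => a j.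
by under eq_fun do rewrite mxE; exact: sU.
Qed.

(** Ties the formal total derivatives to calculus: in [Dvec i] the entry of word l is the variable
    of word [i :: l], which on the jet of a section is the i-th partial of the l-th derivative. *)
Lemma derive_jetof k z (X : 'rV[R]_4) : U z ->
  'D_X (jetof k s) z = hvec X (jetof k.+1 s z).
Proof.
move=> Uz.
have dm : differentiable (fun z => (jetof k s z).2) z.
  apply: differentiable_mx => a j.
  by under eq_fun do rewrite mxE; exact: sU.
have -> : 'D_X (jetof k s) z = (X, 'D_X (fun z => (jetof k s z).2) z).
  rewrite !deriveE //; last exact: jetof_differentiable.
  by rewrite (@diff_pair _ _ _ _ id (fun z => (jetof k s z).2)) // diff_val.
have -> : hvec X (jetof k.+1 s z) = (X, \sum_i X 0 i *: (Dvec i (jetof k.+1 s z)).2).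
  have S (I : Type) (r : seq I) (F : I -> jet R k) :
      \sum_(x <- r) F x = (\sum_(x <- r) (F x).1, \sum_(x <- r) (F x).2).
    elim: r => [|x r IH]; first by rewrite !big_nil.
    by rewrite !big_cons IH.
  by rewrite /hvec S; congr (_, _); rewrite {2}[X]row_sum_delta.
congr (_, _); apply/matrixP => a j.
rewrite derive_mxE; last by move=> b j'; under eq_fun do rewrite mxE; exact: sU.
rewrite mxE summxE (_ : (fun w => _) = partials (word (enum_val j)) (fun z => s z 0 a)); last first.
  by apply/funext => w; rewrite mxE.
rewrite derive_partial; last exact: sU.
apply: eq_bigr => i _; rewrite !mxE jcoord_jetof //.
by rewrite /= ltnS word_size.
Qed.

End Sections.
End JetCoordinates.

(** * Total derivatives of the invariants *)

Section DerivationRules.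
Context {R : realType} {V : normedModType R} (x v : V).
Implicit Types f g : V -> R.

(** These rules are stated for functions written pointwise, the form in which the invariants unfold,
    so that [is_derive_tac] can follow the syntax. *)
Lemma is_derive_add f g df dg : is_derive x v f df -> is_derive x v g dg ->
  is_derive x v (fun y => f y + g y) (df + dg).
Proof. exact: is_deriveD. Qed.

Lemma is_derive_opp f df : is_derive x v f df -> is_derive x v (fun y => - f y) (- df).
Proof. exact: is_deriveN. Qed.

Lemma is_derive_mul f g df dg : is_derive x v f df -> is_derive x v g dg ->
  is_derive x v (fun y => f y * g y) (df * g x + f x * dg).
Proof.
move=> Df Dg; apply: (is_derive_eq (is_deriveM Df Dg)).
by rewrite addrC [_ *: df]mulrC.
Qed.

Lemma is_derive_const (c : R) : is_derive x v (fun=> c) 0.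
Proof. exact: is_derive_cst. Qed.

Lemma is_derive_sqr f df : is_derive x v f df ->
  is_derive x v (fun y => f y ^+ 2) (2 * f x * df).
Proof.
move=> Df; apply: (is_derive_eq (is_derive_mul Df Df)).
by ring.
Qed.

Lemma is_derive_div f g df dg : g x != 0 -> is_derive x v f df -> is_derive x v g dg ->
  is_derive x v (fun y => f y / g y) ((df * g x - f x * dg) / g x ^+ 2).
Proof.
move=> g0 Df Dg.
have Di : is_derive x v (fun y => (g y)^-1) (- g x ^- 2 * dg).
  have [Dg1 Dg2] := Dg.
  by apply: DeriveDef; [exact: derivableV|rewrite deriveV // Dg2].
apply: (is_derive_eq (is_derive_mul Df Di)).
by field.
Qed.

End DerivationRules.

Ltac is_derive_tac :=
  repeat first [ apply: is_derive_div | apply: is_derive_add | apply: is_derive_opp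
    | apply: is_derive_mul | apply: is_derive_sqr | apply: is_derive_const
    | apply: jcoord_is_derive ].

Section Invariants.
Context {R : realType}.
Implicit Types (th : jet R 3) (i : 'I_4).

Definition deth k (th : jet R k) : R :=
  jcoord th ch11 [::] * jcoord th ch22 [::] - jcoord th ch12 [::] ^+ 2.

Lemma posdef_det (y : 'rV[R]_6) :
  posdef y -> 0 < y 0 ch11 /\ 0 < y 0 ch11 * y 0 ch22 - y 0 ch12 ^+ 2.
Proof.
move=> py; have h11 : 0 < y 0 ch11.
  by have := py 1 0; rewrite oner_eq0 => /(_ isT); rewrite !(expr1n, mulr1, mulr0, expr0n, addr0).
(* At (-h_12, h_11) the quadratic form takes the value h_11 (h_11 h_22 - h_12^2). *)
have := py (- y 0 ch12) (y 0 ch11); rewrite (lt0r_neq0 h11) orbT => /(_ isT).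
set a := y 0 ch11 in h11 *; set b := y 0 ch12; set c := y 0 ch22 => H; split=> //.
by rewrite -(pmulr_rgt0 _ h11); move: H; congr (0 < _); ring.
Qed.

Lemma posdef_deth k (th : jet R k) :
  posdef (jval th) -> 0 < jcoord th ch11 [::] /\ 0 < deth th.
Proof. by move/posdef_det; rewrite !mxE. Qed.

Definition I1num k (th : jet R k) : R :=
  let h11 := jcoord th ch11 [::] in
  let h12 := jcoord th ch12 [::] in
  let h22 := jcoord th ch22 [::] in
  let W1v := jcoord th cW1 [:: iv] in
  let W2v := jcoord th cW2 [:: iv] in
  W1v ^+ 2 * h22 - 2 * W1v * W2v * h12 + W2v ^+ 2 * h11.

(** The total derivative of [I1num] along D_i, written out by Leibniz's rule; its vanishing for i =
    v and its polynomiality on fibers can be read off. *)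
Definition dI1num k i (th : jet R k) : R :=
  let h11 := jcoord th ch11 [::] in
  let h12 := jcoord th ch12 [::] in
  let h22 := jcoord th ch22 [::] in
  let W1v := jcoord th cW1 [:: iv] in
  let W2v := jcoord th cW2 [:: iv] in
  let dW1v := jcoord th cW1 [:: i; iv] in
  let dW2v := jcoord th cW2 [:: i; iv] in
  2 * W1v * dW1v * h22 + W1v ^+ 2 * jcoord th ch22 [:: i]
  - 2 * (dW1v * W2v * h12 + W1v * dW2v * h12 + W1v * W2v * jcoord th ch12 [:: i])
  + 2 * W2v * dW2v * h11 + W2v ^+ 2 * jcoord th ch11 [:: i].

Definition ddeth k i (th : jet R k) : R :=
  jcoord th ch11 [:: i] * jcoord th ch22 [::] + jcoord th ch11 [::] * jcoord th ch22 [:: i]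
  - 2 * jcoord th ch12 [::] * jcoord th ch12 [:: i].

Definition I2bq k (th : jet R k) : R :=
  jcoord th cW1 [:: ix2; iv] - jcoord th cW2 [:: ix1; iv].

Definition dI2bq k i (th : jet R k) : R :=
  jcoord th cW1 [:: i; ix2; iv] - jcoord th cW2 [:: i; ix1; iv].

Lemma Dtot_I2a i th : Dtot i (@I2a R) th = jcoord th cH [:: i; iv; iv].
Proof.
by rewrite /Dtot /I2a (derive_val (is_derive := jcoord_is_derive _ _ _ _)) jcoord_Dvec.
Qed.

Lemma Dtot_I1 i th : deth th != 0 ->
  Dtot i (@I1 R) th = (dI1num i th * deth th - I1num th * ddeth i th) / deth th ^+ 2.
Proof.
move=> D0.
have D0' : deth (trunc th) != 0 by rewrite /deth !jcoord_trunc.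
rewrite /Dtot; apply: derive_val; apply: is_derive_eq; first by is_derive_tac.
rewrite /= !jcoord_trunc // !jcoord_Dvec // /deth /I1num /dI1num /ddeth.
congr (_ / _); ring.
Qed.

Lemma Dtot_I2b i th : deth th != 0 ->
  Dtot i (@I2b R) th =
  (2 * I2bq th * dI2bq i th * deth th - I2bq th ^+ 2 * ddeth i th) / deth th ^+ 2.
Proof.
move=> D0.
have D0' : deth (trunc th) != 0 by rewrite /deth !jcoord_trunc.
rewrite /Dtot; apply: derive_val; apply: is_derive_eq; first by is_derive_tac.
rewrite /= !jcoord_trunc // !jcoord_Dvec // /deth /I2bq /dI2bq /ddeth.
congr (_ / _); ring.
Qed.

Lemma I1_differentiable (th : jet R 2) : deth th != 0 -> differentiable (@I1 R) th.
Proof.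
move=> D0.
have J a l : differentiable (fun th : jet R 2 => jcoord th a l) th.
  exact: (@ex_diff _ _ _ _ _ _ _ (jcoord_diff a l th)).
rewrite /I1; apply: differentiableM; last apply: differentiableV => //;
  repeat first [exact: J | exact: differentiable_cst | apply: differentiableD
   | apply: differentiableN | apply: differentiableM | apply: differentiableX].
Qed.

Lemma I2a_differentiable (th : jet R 2) : differentiable (@I2a R) th.
Proof. exact: (@ex_diff _ _ _ _ _ _ _ (jcoord_diff cH [:: iv; iv] th)). Qed.

Lemma I2b_differentiable (th : jet R 2) : deth th != 0 -> differentiable (@I2b R) th.
Proof.
move=> D0.
have J a l : differentiable (fun th : jet R 2 => jcoord th a l) th.
  exact: (@ex_diff _ _ _ _ _ _ _ (jcoord_diff a l th)).
rewrite /I2b; apply: differentiableM; last apply: differentiableV => //;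
  repeat first [exact: J | exact: differentiable_cst | apply: differentiableD
   | apply: differentiableN | apply: differentiableM | apply: differentiableX].
Qed.

Section EtildeZero.
Context (th : jet R 3) (Eth : Etilde th).

Lemma Etilde_h c l : c \in [:: ch11; ch12; ch22] -> iv \in l -> (size l <= 3)%N ->
  jcoord th c l = 0.
Proof.
move=> cin vl sl; have [_ H _ _] := Eth.
have p : perm_eq l (rem iv l ++ [:: iv]).
  by rewrite (perm_trans (perm_to_rem vl)) // -cat1s perm_catC.
by rewrite (jcoord_perm _ _ p) H // -(perm_size p).
Qed.

Lemma Etilde_W c l : c \in [:: cW1; cW2] -> (size l <= 1)%N ->
  jcoord th c [:: iv, iv & l] = 0.
Proof.
move=> cin sl; have [_ _ H _] := Eth.
rewrite (@jcoord_perm _ _ _ _ _ (l ++ [:: iv; iv])); last by rewrite perm_sym perm_catC.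
by rewrite H // size_cat addn2 !ltnS.
Qed.

(** Every term of the three derivatives contains one of h_v, W_vv, H_vvv or an x-derivative of W_vv
    as a factor. *)
Lemma Etilde_dvI :
  [/\ Dtot iv (@I1 R) th = 0, Dtot iv (@I2a R) th = 0 & Dtot iv (@I2b R) th = 0].
Proof.
have [pd _ _ HH] := Eth; have [_ D0] := posdef_deth pd.
have hh c : c \in [:: ch11; ch12; ch22] -> jcoord th c [:: iv] = 0 by move=> ?; apply: Etilde_h.
have hv := (hh ch11 isT, hh ch12 isT, hh ch22 isT).
have W1 : jcoord th cW1 [:: iv; iv] = 0 by apply: Etilde_W.
have W2 : jcoord th cW2 [:: iv; iv] = 0 by apply: Etilde_W.
have W12 : jcoord th cW1 [:: iv; ix2; iv] = 0.
  by rewrite (@jcoord_perm _ _ _ _ _ [:: iv; iv; ix2]) ?Etilde_W.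
have W21 : jcoord th cW2 [:: iv; ix1; iv] = 0.
  by rewrite (@jcoord_perm _ _ _ _ _ [:: iv; iv; ix1]) ?Etilde_W.
have dd : ddeth iv th = 0 by rewrite /ddeth !hv !(mul0r, mulr0, addr0, subr0).
split.
- rewrite Dtot_I1 ?lt0r_neq0 // dd /dI1num /= !hv W1 W2.
  by rewrite !(mulr0, mul0r, addr0, subr0).
- by rewrite Dtot_I2a (HH [::]).
- rewrite Dtot_I2b ?lt0r_neq0 // dd /dI2bq W12 W21.
  by rewrite !(mulr0, mul0r, addr0, subr0).
Qed.

End EtildeZero.
End Invariants.

(** * Vanishing of all derivatives at a point *)

Section Flatness.
Context {R : realType}.
Implicit Types (U : set 'rV[R]_4) (f g : 'rV[R]_4 -> R) (p z : 'rV[R]_4).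
Implicit Types (n : nat) (l : seq 'I_4) (i j : 'I_4).

(** The n-jet at [p] vanishes. The order is finite because composition is handled by induction on
    it; flatness to all orders appears as [forall N, flat N p f]. *)
Definition flat n p f := forall l, (size l <= n)%N -> partials l f p = 0.

Lemma flat_le m n p f : (m <= n)%N -> flat n p f -> flat m p f.
Proof. by move=> mn Ff l sl; apply: Ff; apply: leq_trans mn. Qed.

Lemma flat_eq U n p f g :
  open U -> U p -> (forall w, U w -> f w = g w) -> flat n p f -> flat n p g.
Proof. by move=> oU Up fg Ff l sl; rewrite -(partials_eq l oU fg Up) Ff. Qed.

Lemma partials_add U f g l z : open U -> smooth U f -> smooth U g -> U z ->
  partials l (fun w => f w + g w) z = partials l f z + partials l g z.
Proof.
move=> oU sf sg; elim: l z => [|i l IH] z Uz //=.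
by rewrite (partial_eq i oU IH Uz) partialD //; [exact: sf|exact: sg].
Qed.

Lemma partials_cat l1 l2 f : partials (l1 ++ l2) f = partials l1 (partials l2 f).
Proof. exact: foldr_cat. Qed.

Lemma partials_cst (c : R) l : l != [::] -> partials l (fun=> c) = fun=> 0.
Proof.
elim: l => // i l IH _; case: (eqVneq l [::]) => [->|/IH /= ->].
  by apply/funext => z; rewrite /= partial_cst.
by apply/funext => z; rewrite /= partial_cst.
Qed.

Lemma flat0 n p : flat n p (fun=> 0).
Proof. by move=> [|i l] _ //; rewrite partials_cst. Qed.

Lemma flatD U n p f g : open U -> U p -> smooth U f -> smooth U g ->
  flat n p f -> flat n p g -> flat n p (fun w => f w + g w).
Proof.
by move=> oU Up sf sg Ff Fg l sl; rewrite (partials_add _ oU) // Ff // Fg // addr0.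
Qed.

(** Functions with vanishing n-jet form an ideal. One derivative leaves f' g and f g', in both of
    which the second factor is flat to one order less. *)
Lemma flatMr U n p f g : open U -> U p -> smooth U f -> smooth U g ->
  flat n p g -> flat n p (fun w => f w * g w).
Proof.
move=> oU Up sf sg Fg l; elim/last_ind: l n f g sf sg Fg => [|l i IH] n f g sf sg Fg.
  by move=> _ /=; have /= -> := Fg [::] isT; rewrite mulr0.
rewrite size_rcons; case: n Fg => // n Fg; rewrite ltnS => sl.
have E w : U w -> partial i (fun w => f w * g w) w = partial i f w * g w + f w * partial i g w.
  by move=> Uw; rewrite partialM //; [exact: (sf [::])|exact: (sg [::])].
have si h : smooth U h -> smooth U (partial i h) by exact: smooth_partial.
have s1 : smooth U (fun w => partial i f w * g w) by apply: smoothM => //; exact: si.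
have s2 : smooth U (fun w => f w * partial i g w) by apply: smoothM => //; exact: si.
rewrite -partials_partial (partials_eq l oU E Up) (partials_add _ oU s1 s2 Up).
rewrite (IH n _ _ (si _ sf) sg) ?(IH n _ _ sf (si _ sg)) ?addr0 //.
  by move=> l' sl'; rewrite partials_partial Fg // size_rcons.
exact: flat_le Fg.
Qed.

Lemma flat_sum U n p (I : Type) (r : seq I) (F : I -> 'rV[R]_4 -> R) :
  open U -> U p -> (forall k, smooth U (F k)) -> (forall k, flat n p (F k)) ->
  flat n p (fun w => \sum_(k <- r) F k w).
Proof.
move=> oU Up sF FF; elim: r => [|k r IH].
  have E w : U w -> 0 = \sum_(k <- [::]) F k w by rewrite big_nil.
  exact: (flat_eq oU Up E (@flat0 n p)).
have E w : U w -> F k w + \sum_(j <- r) F j w = \sum_(j <- k :: r) F j w by rewrite big_cons.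
exact: (flat_eq oU Up E (flatD oU Up (sF k) (smooth_sum r oU sF) (FF k) IH)).
Qed.

Lemma flat_partial n p f i : flat n.+1 p f -> flat n p (partial i f).
Proof. by move=> Ff l sl; rewrite partials_partial Ff // size_rcons. Qed.

(** The chain rule writes a derivative of the composite as a combination, with smooth coefficients,
    of pulled back derivatives of [f]; these are flat to one order less, and [flatMr] absorbs the
    coefficients. *)
Lemma flat_comp U U' (phi : 'rV[R]_4 -> 'rV[R]_4) n p f :
  open U -> U p -> (forall z, U z -> U' (phi z)) -> smooth_on U phi -> smooth U' f ->
  flat n (phi p) f -> flat n p (f \o phi).
Proof.
move=> oU Up UU' sphi; elim: n f => [|n IH] f sf Ff l.
  by case: l => // _; apply: (Ff [::]).
case/lastP: l => [_|l i]; first exact: (Ff [::]).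
rewrite size_rcons ltnS => sl; rewrite -partials_partial.
have E w : U w -> partial i (f \o phi) w =
    \sum_j partial i (fun w => phi w 0 j) w * (partial j f \o phi) w.
  move=> Uw; rewrite partial_comp; last by apply: (sf [::]); apply: UU'.
    by apply: eq_bigr => j _; rewrite mulrC.
  by move=> j; apply: (sphi j [::]).
rewrite (partials_eq l oU E Up).
have sJ j : smooth U (partial i (fun w => phi w 0 j)) by apply/smooth_partial/(sphi j).
have sC j : smooth U (partial j f \o phi).
  exact: (smooth_comp oU UU' sphi (smooth_partial j sf)).
apply: (@flat_sum U n p _ _ (fun j w => partial i (fun w => phi w 0 j) w * (partial j f \o phi) w)
  oU Up _ _ l sl) => j; first exact: smoothM.
by apply: (flatMr oU Up) => //; apply: IH; [exact: smooth_partial|exact: flat_partial].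
Qed.

End Flatness.

(** * Transformation of the metric coefficients *)

Section KundtCoefficients.
Context {R : realType}.
Implicit Types (y : 'rV[R]_6) (X Y : 'rV[R]_4).

Notation e i := (delta_mx 0 i : 'rV[R]_4).

Lemma sum4 (F : 'I_4 -> R) : \sum_i F i = F iu + F ix1 + F ix2 + F iv.
Proof.
rewrite !big_ord_recl big_ord0 addr0 !addrA.
by congr (F _ + F _ + F _ + F _); apply/val_inj.
Qed.

Lemma kundt_sum y X Y :
  kundt y X Y = \sum_c \sum_d X 0 c * Y 0 d * kundt y (e c) (e d).
Proof. rewrite !sum4 /kundt !mxE /=; by field. Qed.

Lemma kundtC y X Y : kundt y X Y = kundt y Y X.
Proof. by rewrite /kundt; field. Qed.

Lemma kundt_uu y : kundt y (e iu) (e iu) = y 0 cH.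
Proof. by rewrite /kundt !mxE /=; field. Qed.
Lemma kundt_u1 y : kundt y (e iu) (e ix1) = y 0 cW1 / 2.
Proof. by rewrite /kundt !mxE /=; field. Qed.
Lemma kundt_u2 y : kundt y (e iu) (e ix2) = y 0 cW2 / 2.
Proof. by rewrite /kundt !mxE /=; field. Qed.
Lemma kundt_11 y : kundt y (e ix1) (e ix1) = y 0 ch11.
Proof. by rewrite /kundt !mxE /=; field. Qed.
Lemma kundt_12 y : kundt y (e ix1) (e ix2) = y 0 ch12.
Proof. by rewrite /kundt !mxE /=; field. Qed.
Lemma kundt_22 y : kundt y (e ix2) (e ix2) = y 0 ch22.
Proof. by rewrite /kundt !mxE /=; field. Qed.
Lemma kundt_v y c : kundt y (e c) (e iv) = (c == iu)%:R / 2.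
Proof. by rewrite /kundt !mxE /=; case: c => [[|[|[|[|]]]] //= ?]; field. Qed.

Lemma ord4_ind (P : 'I_4 -> Prop) : P iu -> P ix1 -> P ix2 -> P iv -> forall i, P i.
Proof.
move=> Pu P1 P2 Pv [[|[|[|[|//]]]] lt_i].
- by rewrite (_ : Ordinal _ = iu) //; apply/val_inj.
- by rewrite (_ : Ordinal _ = ix1) //; apply/val_inj.
- by rewrite (_ : Ordinal _ = ix2) //; apply/val_inj.
- by rewrite (_ : Ordinal _ = iv) //; apply/val_inj.
Qed.

End KundtCoefficients.

(** * Derivatives along v of the transformation law *)

Section KundtMaps.
Context {R : realType}.
Implicit Types (s : 'rV[R]_4 -> 'rV[R]_6) (phi : 'rV[R]_4 -> 'rV[R]_4) (U : set 'rV[R]_4).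
Implicit Types (p z : 'rV[R]_4) (a b c d i j k : 'I_4).

Notation e i := (delta_mx 0 i : 'rV[R]_4).

Definition gc s a b (z : 'rV[R]_4) : R := kundt (s z) (e a) (e b).

Definition jac phi a c : 'rV[R]_4 -> R := partial a (fun w => phi w 0 c).

(* G_ab is quadratic in v for a = b = u, linear in v if exactly one index is u,
   and independent of v otherwise: [(wt a + wt b).+1] v-derivatives annihilate it. *)
Definition wt a : nat := a == iu.

Definition dv (n : nat) (f : 'rV[R]_4 -> R) : 'rV[R]_4 -> R := partials (nseq n iv) f.

Definition ordc (c : 'I_6) : nat :=
  if c == cH then 3 else if c \in [:: cW1; cW2] then 2 else 1.

(** Each G_ab is a fiber coordinate times 1 or 1/2, or, when v occurs among the indices, a constant.
    The final alternative records that in the first case the v-order of the coordinate's Kundt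
    equation agrees with the weight of the pair of indices. *)
Lemma gc_affine a b : exists (c : 'I_6) (x y : R),
  (forall q, kundt q (e a) (e b) = x * q 0 c + y) /\ (x = 0 \/ ordc c = (wt a + wt b).+1).
Proof.
have C (b' a' : 'I_4) : (exists (c : 'I_6) (x y : R), (forall q, kundt q (e a') (e b') = x * q 0 c + y)
    /\ (x = 0 \/ ordc c = (wt a' + wt b').+1)) ->
  exists (c : 'I_6) (x y : R), (forall q, kundt q (e b') (e a') = x * q 0 c + y)
    /\ (x = 0 \/ ordc c = (wt b' + wt a').+1).
  move=> [c [x [y [H1 H2]]]]; exists c, x, y; rewrite [(wt b' + _)%N]addnC; split=> // q.
  by rewrite kundtC.
have V a' : exists (c : 'I_6) (x y : R), (forall q, kundt q (e a') (e iv) = x * q 0 c + y)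
    /\ (x = 0 \/ ordc c = (wt a' + wt iv).+1).
  (* The entry is constant, so [cH] is a placeholder with coefficient 0. *)
  by exists cH, 0, ((a' == iu)%:R / 2); split=> [q|]; [rewrite kundt_v mul0r add0r|left].
elim/ord4_ind: a; elim/ord4_ind: b.
- by exists cH, 1, 0; split=> [q|]; [rewrite kundt_uu mul1r addr0|right].
- by exists cW1, 2^-1, 0; split=> [q|]; [rewrite kundt_u1 mulrC addr0|right].
- by exists cW2, 2^-1, 0; split=> [q|]; [rewrite kundt_u2 mulrC addr0|right].
- exact: V.
- by apply: C; exists cW1, 2^-1, 0; split=> [q|]; [rewrite kundt_u1 mulrC addr0|right].
- by exists ch11, 1, 0; split=> [q|]; [rewrite kundt_11 mul1r addr0|right].
- by exists ch12, 1, 0; split=> [q|]; [rewrite kundt_12 mul1r addr0|right].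
- exact: V.
- by apply: C; exists cW2, 2^-1, 0; split=> [q|]; [rewrite kundt_u2 mulrC addr0|right].
- by apply: C; exists ch12, 1, 0; split=> [q|]; [rewrite kundt_12 mul1r addr0|right].
- by exists ch22, 1, 0; split=> [q|]; [rewrite kundt_22 mul1r addr0|right].
- exact: V.
- by apply: C; exact: V.
- by apply: C; exact: V.
- by apply: C; exact: V.
- exact: V.
Qed.

Lemma smooth_gc U s a b : open U -> smooth_on U s -> smooth U (gc s a b).
Proof.
move=> oU sU; have [c [x [y [E _]]]] := gc_affine a b.
have E' w : U w -> x * s w 0 c + y = gc s a b w by rewrite /gc E.
apply: (smooth_eq oU E'); apply: smoothD => //; last exact: smooth_cst.
by apply: smoothM => //; [exact: smooth_cst|exact: sU].
Qed.

Lemma smooth_dv U n f : smooth U f -> smooth U (dv n f).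
Proof. exact: smooth_partials. Qed.

Lemma gcv s a z : gc s a iv z = (a == iu)%:R / 2.
Proof. exact: kundt_v. Qed.

Lemma dv_gcv s n a : dv n.+1 (gc s a iv) = fun=> 0.
Proof.
rewrite /dv (_ : gc s a iv = fun=> (a == iu)%:R / 2) ?partials_cst //.
by apply/funext => z; rewrite /gc kundt_v.
Qed.

Lemma gcC s a b : gc s a b = gc s b a.
Proof. by apply/funext => z; rewrite /gc kundtC. Qed.

Lemma dv_gcv' s n a : dv n.+1 (gc s iv a) = fun=> 0.
Proof. by rewrite gcC dv_gcv. Qed.

Lemma partial_sum (I : Type) (r : seq I) (F : I -> 'rV[R]_4 -> R) i z :
  (forall x, differentiable (F x) z) ->
  partial i (fun w => \sum_(x <- r) F x w) z = \sum_(x <- r) partial i (F x) z.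
Proof.
move=> dF.
have [//] : differentiable (fun w => \sum_(x <- r) F x w) z /\
  partial i (fun w => \sum_(x <- r) F x w) z = \sum_(x <- r) partial i (F x) z.
elim: r => [|x r [IHd IH]].
  have -> : (fun w => \sum_(x <- [::]) F x w) = fun=> 0 by apply/funext => w; rewrite big_nil.
  by rewrite big_nil partial_cst; split=> //; exact: differentiable_cst.
have -> : (fun w => \sum_(x <- x :: r) F x w) = (fun w => F x w + \sum_(x <- r) F x w).
  by apply/funext => w; rewrite big_cons.
by rewrite big_cons partialD // IH; split=> //; exact: differentiableD.
Qed.

Lemma sum_delta_iv (x : R) (X Y Z : 'I_4 -> 'I_4 -> R) :
  \sum_c \sum_d (x * X c d + (c == iv)%:R * Y c d + (d == iv)%:R * Z c d) =
  x * (\sum_c \sum_d X c d) + \sum_d Y iv d + \sum_c Z c iv.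
Proof. by rewrite !sum4 /=; ring. Qed.

(* The Jacobian J of phi is a parameter of its own, so that computations treat its
   entries as atoms instead of unfolding derivatives. *)
Record kmap U U' phi (J : 'I_4 -> 'I_4 -> 'rV[R]_4 -> R) s s' : Prop := Kmap {
  km_oU : open U;
  km_oU' : open U';
  km_map : forall z, U z -> U' (phi z);
  km_phi : smooth_on U phi;
  km_s : smooth_on U s;
  km_s' : smooth_on U' s';
  km_J : forall a c, J a c = jac phi a c;
  km_v : forall c z, U z -> c != iv -> J iv c z = 0;
  km_x1 : forall z, U z -> J ix1 iu z = 0;
  km_x2 : forall z, U z -> J ix2 iu z = 0;
  km_T : forall a b z, U z -> gc s a b z =
    \sum_c \sum_d gc s' c d (phi z) * J a c z * J b d z }.

Section OneMap.
Context U U' phi J s s' (K : kmap U U' phi J s s').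

Notation lift F a b := (fun w : 'rV[R]_4 =>
  \sum_c \sum_d F c d (phi w) * J a c w * J b d w).

Let oU : open U := km_oU K.
Let oU' : open U' := km_oU' K.

Lemma smooth_J a c : smooth U (J a c).
Proof. by rewrite (km_J K); exact/smooth_partial/(km_phi K). Qed.

Lemma smooth_pull f : smooth U' f -> smooth U (fun w => f (phi w)).
Proof. exact: (smooth_comp oU (km_map K) (km_phi K)). Qed.

Lemma smooth_G a b : smooth U (gc s a b).
Proof. exact: smooth_gc oU (km_s K). Qed.

Lemma smooth_G' a b : smooth U' (gc s' a b).
Proof. exact: smooth_gc oU' (km_s' K). Qed.

Lemma jac_u0 a z : U z -> a != iu -> J a iu z = 0.
Proof.
move=> Uz; elim/ord4_ind: a => // _; [exact: (km_x1 K Uz)|exact: (km_x2 K Uz)|].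
exact: (km_v K Uz).
Qed.

Lemma jac_v z : U z -> (J iv iu z = 0) * (J iv ix1 z = 0) * (J iv ix2 z = 0).
Proof. by move=> Uz; rewrite !(km_v K Uz). Qed.

Lemma jac_comm k a c z : U z -> partial k (J a c) z = partial a (J k c) z.
Proof. by move=> Uz; rewrite !(km_J K); apply: partial_comm oU (km_phi K c) Uz. Qed.

Lemma partial_pull f k z : smooth U' f -> U z ->
  partial k (fun w => f (phi w)) z = \sum_j partial j f (phi z) * J k j z.
Proof.
move=> sf Uz; have dphi j : differentiable (fun w => phi w 0 j) z by apply: (km_phi K j [::]).
rewrite [LHS](partial_comp k dphi (smooth_diff sf (km_map K Uz))).
by apply: eq_bigr => j _; rewrite (km_J K).
Qed.

Lemma partial_v_pull f z : smooth U' f -> U z ->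
  partial iv (fun w => f (phi w)) z = partial iv f (phi z) * J iv iv z.
Proof.
move=> sf Uz; rewrite partial_pull // (bigD1 iv) //= big1 ?addr0 // => j jv.
by rewrite (km_v K Uz jv) mulr0.
Qed.

Lemma partial_zero f k z : (forall w, U w -> f w = 0) -> U z -> partial k f z = 0.
Proof. by move=> f0 Uz; rewrite (partial_eq k oU f0 Uz) partial_cst. Qed.

(** G_uv = 1/2 for both metrics, and in its transformation law only the term c = u, d = v
    survives. *)
Lemma jac_uv1 z : U z -> J iu iu z * J iv iv z = 1.
Proof.
move=> Uz; have := km_T K iu iv Uz.
rewrite !sum4 !(jac_v Uz) !gcv (gcC _ iv) !gcv /=; lra.
Qed.

Lemma jac_vv_neq0 z : U z -> J iv iv z != 0.
Proof. by move/jac_uv1 => E; apply/negP => /eqP e0; move: E; rewrite e0 mulr0 => /eqP; rewrite eq_sym oner_eq0. Qed.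

Lemma jac_uu_neq0 z : U z -> J iu iu z != 0.
Proof. by move/jac_uv1 => E; apply/negP => /eqP e0; move: E; rewrite e0 mul0r => /eqP; rewrite eq_sym oner_eq0. Qed.

(** [J iv iv] is the inverse of [J iu iu], which varies with u alone: its k-derivative is the
    u-derivative of [J k iu], and this entry is zero. *)
Lemma partial_jac_vv k z : U z -> k != iu -> partial k (J iv iv) z = 0.
Proof.
move=> Uz ku.
have : partial k (fun w => J iu iu w * J iv iv w) z = 0.
  by rewrite (partial_eq k oU jac_uv1 Uz) partial_cst.
rewrite partialM; [|exact: (smooth_J _ _ [::])..].
rewrite (jac_comm _ _ _ Uz) (@partial_zero (J k iu)) //; last by move=> w Uw; apply: jac_u0.
rewrite mul0r add0r => /eqP; rewrite mulf_eq0 (negPf (jac_uu_neq0 Uz)) /=; exact/eqP.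
Qed.

Lemma partial_v_jac a c z : U z -> c != iv -> partial iv (J a c) z = 0.
Proof.
by move=> Uz cv; rewrite jac_comm // partial_zero // => w Uw; apply: km_v K _ _ Uw cv.
Qed.

Lemma smooth_lift (F : 'I_4 -> 'I_4 -> 'rV[R]_4 -> R) a b :
  (forall c d, smooth U' (F c d)) -> smooth U (lift F a b).
Proof.
move=> sF; apply: smooth_sum => // c; apply: smooth_sum => // d.
by apply: smoothM => //; [apply: smoothM => //; [exact: smooth_pull|]|]; exact: smooth_J.
Qed.

(** Leibniz's rule: on a pullback the v-derivative yields the factor [J iv iv], and on [J a c] it
    equals the a-derivative of [J iv c], which is zero unless c = v. *)
Lemma partial_v_lift (F : 'I_4 -> 'I_4 -> 'rV[R]_4 -> R) a b z :
  (forall c d, smooth U' (F c d)) -> U z ->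
  partial iv (lift F a b) z =
    J iv iv z * lift (fun c d => partial iv (F c d)) a b z
    + (\sum_d F iv d (phi z) * J b d z) * partial a (J iv iv) z
    + (\sum_c F c iv (phi z) * J a c z) * partial b (J iv iv) z.
Proof.
move=> sF Uz.
have dF c d : differentiable (fun w => F c d (phi w)) z.
  exact: (smooth_pull (sF c d) [::]).
have dJ a' c : differentiable (J a' c) z by exact: (smooth_J a' c [::]).
have E c d : partial iv (fun w => F c d (phi w) * J a c w * J b d w) z =
    J iv iv z * (partial iv (F c d) (phi z) * J a c z * J b d z)
    + (c == iv)%:R * (F c d (phi z) * J b d z * partial a (J iv iv) z)
    + (d == iv)%:R * (F c d (phi z) * J a c z * partial b (J iv iv) z).
  rewrite partialM //; last exact: differentiableM.
  rewrite partialM // partial_v_pull //.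
  have EJ a' c' : partial iv (J a' c') z = (c' == iv)%:R * partial a' (J iv iv) z.
    case: (eqVneq c' iv) => [->|cv]; first by rewrite jac_comm // mul1r.
    by rewrite partial_v_jac // mul0r.
  rewrite !EJ; move: (partial iv _ _) (partial a _ _) (partial b _ _) (F c d _) => x1 x2 x3 x4.
  by move: (J _ _ _) (J _ _ _) (J _ _ _) => y1 y2 y3; ring.
rewrite partial_sum; last first.
  move=> c; apply: (@smooth_diff _ U _ _ _ Uz).
  apply: smooth_sum => // d; apply: smoothM => //; last exact: smooth_J.
  by apply: smoothM => //; [exact: smooth_pull|exact: smooth_J].
under eq_bigr => c _.
  rewrite partial_sum; last by move=> d; do 2?apply: differentiableM.
  under eq_bigr => d _ do rewrite E.
  over.
rewrite (sum_delta_iv (J iv iv z) (fun c d => partial iv (F c d) (phi z) * J a c z * J b d z)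
  (fun c d => F c d (phi z) * J b d z * partial a (J iv iv) z)
  (fun c d => F c d (phi z) * J a c z * partial b (J iv iv) z)).
by rewrite !mulr_suml.
Qed.

(** Contribution of the constant entries G'_uv = 1/2 when the first v-derivative falls on a Jacobian
    factor. At a = b = u it equals -C''/C' for a map of the pseudogroup. *)
Definition kappa a b (z : 'rV[R]_4) : R :=
  2^-1 * (partial a (J iv iv) z * J b iu z + J a iu z * partial b (J iv iv) z).

Lemma kappa0 a b z : U z -> (a != iu) || (b != iu) -> kappa a b z = 0.
Proof.
by move=> Uz /orP[]Hu; rewrite /kappa (jac_u0 Uz Hu) (partial_jac_vv Uz Hu) !(mul0r, mulr0, addr0).
Qed.

(** After one v-derivative the entries G'_cv have become zero, so further derivatives leave no terms
    from the Jacobian factors; moreover [J iv iv] and [kappa] do not vary with v. *)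
Lemma dv_G n a b z : U z ->
  dv n.+1 (gc s a b) z =
    J iv iv z ^+ n.+1 * lift (fun c d => dv n.+1 (gc s' c d)) a b z
    + (n == 0%N)%:R * kappa a b z.
Proof.
have sG := smooth_G'; elim: n z => [|n IH] z Uz.
  rewrite /dv /= (partial_eq iv oU (fun w => @km_T _ _ _ _ _ _ K a b w) Uz) partial_v_lift // mul1r expr1.
  rewrite -addrA; congr (_ + _).
  by rewrite !sum4 /gc !(kundt_v, kundtC _ (e iv)) /kappa /=; ring.
rewrite -[dv n.+2 _]/(partial iv (dv n.+1 _)) (partial_eq iv oU IH Uz) mul0r addr0.
have sK : smooth U (kappa a b).
  apply: smoothM => //; first exact: smooth_cst.
  by apply: smoothD => //; apply: smoothM => //; first [exact: smooth_J | apply: smooth_partial; exact: smooth_J].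
have sE m : smooth U (fun w => J iv iv w ^+ m).
  elim: m => [|m IHm]; first exact: smooth_cst.
  by under eq_fun do rewrite exprS; apply: smoothM => //; exact: smooth_J.
have sL : smooth U (lift (fun c d => dv n.+1 (gc s' c d)) a b).
  by apply: (smooth_lift (F := fun c d => dv n.+1 (gc s' c d))) => c d; apply: smooth_dv.
have dE m : partial iv (fun w => J iv iv w ^+ m) z = 0.
  elim: m => [|m IHm]; first exact: partial_cst.
  under eq_fun do rewrite exprS.
  rewrite partialM; [|exact: (smooth_J _ _ [::])|exact: (sE _ [::])].
  by rewrite IHm partial_jac_vv // mul0r mulr0 addr0.
have dK : partial iv (kappa a b) z = 0.
  rewrite partialM; first last.
  - by apply: differentiableD; apply: differentiableM;
      first [exact: (smooth_J _ _ [::]) | exact: (smooth_partial _ (smooth_J _ _) [::])].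
  - exact: differentiable_cst.
  have P0 a' : partial iv (partial a' (J iv iv)) z = 0.
    rewrite (partial_comm _ _ oU (smooth_J _ _) Uz) partial_zero // => w Uw.
    exact: partial_jac_vv.
  rewrite partial_cst partialD; [|by apply: differentiableM;
      first [exact: (smooth_J _ _ [::]) | exact: (smooth_partial _ (smooth_J _ _) [::])]..].
  rewrite !partialM; [|by
      first [exact: (smooth_J _ _ [::]) | exact: (smooth_partial _ (smooth_J _ _) [::])]..].
  by rewrite !P0 !partial_v_jac // !(mul0r, mulr0, addr0).
rewrite partialD; first last.
- by apply: differentiableM; [exact: differentiable_cst|exact: (sK [::])].
- by apply: differentiableM; [exact: (sE _ [::])|exact: (sL [::])].
rewrite partialM; [|exact: (sE _ [::])|exact: (sL [::])].
rewrite partialM; [|exact: differentiable_cst|exact: (sK [::])].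
rewrite dE dK partial_cst !(mul0r, mulr0, addr0) add0r.
rewrite (partial_v_lift (F := fun c d => dv n.+1 (gc s' c d))) //; last first.
  by move=> c d; apply: smooth_dv.
rewrite [X in _ + X * _ + _]big1; last by move=> d _; rewrite dv_gcv' mul0r.
rewrite [X in _ + X * _]big1; last by move=> d _; rewrite dv_gcv mul0r.
by rewrite !(mul0r, addr0) mulrA -exprSr.
Qed.

End OneMap.
End KundtMaps.

(** * Invariance of the Kundt equations *)

Section FieldEquations.
Context {R : realType}.
Implicit Types (s : 'rV[R]_4 -> 'rV[R]_6) (phi : 'rV[R]_4 -> 'rV[R]_4) (U : set 'rV[R]_4).
Implicit Types (p z : 'rV[R]_4) (a b c d i j : 'I_4).

Notation e i := (delta_mx 0 i : 'rV[R]_4).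

(** The infinite prolongation of the Kundt equations at [p], stated for the entries G_ab, on which
    the transformation law acts, instead of the six coefficients. *)
Definition kundt_eqs s p :=
  forall N a b, flat N p (dv (wt a + wt b).+1 (gc s a b)).

Lemma partials_scale U (x : R) (f : 'rV[R]_4 -> R) l z : open U -> smooth U f -> U z ->
  partials l (fun w => x * f w) z = x * partials l f z.
Proof.
move=> oU sf; elim: l z => [//|i l IH] z Uz.
rewrite [LHS](partial_eq i oU IH Uz) partialM; [|exact: differentiable_cst|exact: sf].
by rewrite partial_cst mul0r add0r.
Qed.

Lemma flat_dv N n p (f : 'rV[R]_4 -> R) : flat (N + n) p f -> flat N p (dv n f).
Proof.
by move=> Ff l sl; rewrite /dv -partials_cat Ff // size_cat size_nseq leq_add2r.
Qed.

Lemma dvD m n (f : 'rV[R]_4 -> R) : dv (m + n) f = dv m (dv n f).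
Proof. by rewrite /dv nseqD partials_cat. Qed.

(** Since [J a iu] is zero for a other than u, the surviving terms satisfy
    [wt c + wt d <= wt a + wt b]: the v-derivatives available suffice to annihilate G'_cd. The
    passage goes from the image to the source. *)
Lemma kundt_eqs_transfer U U' phi J s s' p :
  kmap U U' phi J s s' -> U p -> kundt_eqs s' (phi p) -> kundt_eqs s p.
Proof.
move=> K Up Q N a b; set n := (wt a + wt b)%N.
have oU := km_oU K; have oU' := km_oU' K.
pose F c d := dv n.+1 (gc s' c d).
have sF c d : smooth U' (F c d) by apply/smooth_dv/(smooth_G' K).
have sJ c d : smooth U (J c d) by exact: smooth_J K _ _.
pose L w := \sum_c \sum_d F c d (phi w) * J a c w * J b d w.
have sE : smooth U (fun w => J iv iv w ^+ n.+1).
  elim: n.+1 => [|m IHm]; first exact: smooth_cst.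
  by under eq_fun do rewrite exprS; apply: smoothM.
have E w : U w -> J iv iv w ^+ n.+1 * L w = dv n.+1 (gc s a b) w.
  move=> Uw; rewrite (dv_G K) // -/(F _ _).
  (* A single v-derivative means weight 0: neither index is u, and [kappa] vanishes. *)
  case: eqP => [n0|]; last by rewrite mul0r addr0.
  rewrite (kappa0 K) ?mulr0 ?addr0 //.
  by move: n0; rewrite /n /wt; case: (a == iu).
have sL : smooth U L by exact: (smooth_lift K _ _ sF).
apply: (flat_eq oU Up E); apply: (flatMr oU Up) => //.
have sT c d : smooth U (fun w => F c d (phi w) * J a c w * J b d w).
  by apply: smoothM => //; apply: smoothM => //; exact: (smooth_pull K).
apply: (@flat_sum _ U N p _ _ (fun c w => \sum_d F c d (phi w) * J a c w * J b d w) oU Up) => c.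
  exact: smooth_sum.
apply: (@flat_sum _ U N p _ _ (fun d w => F c d (phi w) * J a c w * J b d w) oU Up) => // d.
case: (boolP ((a != iu) && (c == iu))) => [/andP[au /eqP cu]|ac].
  have Z w : U w -> 0 = F c d (phi w) * J a c w * J b d w.
    by move=> Uw; rewrite cu (jac_u0 K Uw au) mulr0 mul0r.
  exact: (flat_eq oU Up Z (@flat0 _ N p)).
case: (boolP ((b != iu) && (d == iu))) => [/andP[bu /eqP du]|bd].
  have Z w : U w -> 0 = F c d (phi w) * J a c w * J b d w.
    by move=> Uw; rewrite du (jac_u0 K Uw bu) mulr0.
  exact: (flat_eq oU Up Z (@flat0 _ N p)).
have Z w : U w -> (J a c w * J b d w) * F c d (phi w) = F c d (phi w) * J a c w * J b d w.
  by move=> Uw; ring.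
apply: (flat_eq oU Up Z); apply: (flatMr oU Up).
- exact: smoothM.
- exact: (smooth_pull K).
apply: (flat_comp oU Up (km_map K) (km_phi K) (sF c d)).
have le : (wt c + wt d <= n)%N.
  by move: ac bd; rewrite /n /wt; do 4!case: (_ == _).
rewrite /F (_ : n.+1 = (n - (wt c + wt d)) + (wt c + wt d).+1)%N; last by rewrite addnS subnK.
by rewrite dvD; apply: flat_dv.
Qed.

Lemma ord6_ind (P : 'I_6 -> Prop) :
  P cH -> P cW1 -> P cW2 -> P ch11 -> P ch12 -> P ch22 -> forall c : 'I_6, P c.
Proof.
move=> P0 P1 P2 P3 P4 P5 [[|[|[|[|[|[|//]]]]]] lt_c].
- by rewrite (_ : Ordinal _ = cH) //; apply/val_inj.
- by rewrite (_ : Ordinal _ = cW1) //; apply/val_inj.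
- by rewrite (_ : Ordinal _ = cW2) //; apply/val_inj.
- by rewrite (_ : Ordinal _ = ch11) //; apply/val_inj.
- by rewrite (_ : Ordinal _ = ch12) //; apply/val_inj.
- by rewrite (_ : Ordinal _ = ch22) //; apply/val_inj.
Qed.

Section Components.
Context U s p (oU : open U) (sU : smooth_on U s) (Up : U p).

Lemma kundt_eqs_of_components :
  (forall (c : 'I_6) N, flat N p (dv (ordc c) (fun w => s w 0 c))) -> kundt_eqs s p.
Proof.
move=> H N a b l sl.
have [c [x [y [E Hx]]]] := @gc_affine R a b.
have -> : gc s a b = fun w => x * s w 0 c + y by apply/funext => w; rewrite /gc E.
have ne : l ++ nseq (wt a + wt b).+1 iv != [::] by case: l {sl}.
rewrite /dv -partials_cat (partials_add _ oU) //; first last.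
- exact: smooth_cst.
- by apply: smoothM => //; [exact: smooth_cst|exact: sU].
rewrite (partials_cst _ ne) addr0 (partials_scale _ _ oU (sU c) Up).
case: Hx => [->|Hc]; first by rewrite mul0r.
by rewrite -Hc partials_cat (H c N) ?mulr0.
Qed.

Lemma components_of_kundt_eqs :
  kundt_eqs s p -> forall (c : 'I_6) N, flat N p (dv (ordc c) (fun w => s w 0 c)).
Proof.
move=> H c N.
have [a [b [x [E Ho]]]] : exists a b (x : R), (forall w, s w 0 c = x * gc s a b w) /\
    ordc c = (wt a + wt b).+1.
  rewrite /gc; elim/ord6_ind: c.
  - by exists iu, iu, 1; split=> // w; rewrite kundt_uu mul1r.
  - by exists iu, ix1, 2; split=> // w; rewrite kundt_u1; field.
  - by exists iu, ix2, 2; split=> // w; rewrite kundt_u2; field.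
  - by exists ix1, ix1, 1; split=> // w; rewrite kundt_11 mul1r.
  - by exists ix1, ix2, 1; split=> // w; rewrite kundt_12 mul1r.
  - by exists ix2, ix2, 1; split=> // w; rewrite kundt_22 mul1r.
move=> l sl; rewrite (_ : (fun w => s w 0 c) = fun w => x * gc s a b w); last exact/funext.
rewrite /dv -partials_cat (partials_scale _ _ oU (smooth_gc _ _ oU sU) Up).
by rewrite Ho partials_cat (H N) ?mulr0.
Qed.

Lemma components_of_Etilde :
  (forall k, Etilde (jetof k s p)) -> forall (c : 'I_6) N, flat N p (dv (ordc c) (fun w => s w 0 c)).
Proof.
move=> E c N l _; set l' := l ++ nseq (ordc c) iv.
have [_ Eh EW EH] := E (size l').
rewrite /dv -partials_cat -/l' -(jcoord_jetof oU sU c Up (leqnn (size l'))) /l'.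
by elim/ord6_ind: c @l' Eh EW EH => l' Eh EW EH;
  [exact: EH|exact: EW|exact: EW|exact: Eh|exact: Eh|exact: Eh].
Qed.

Lemma Etilde_of_components k : posdef (s p) ->
  (forall (c : 'I_6) N, flat N p (dv (ordc c) (fun w => s w 0 c))) -> Etilde (jetof k s p).
Proof.
move=> pd H.
have Z (c : 'I_6) l : (size (l ++ nseq (ordc c) iv) <= k)%N ->
    jcoord (jetof k s p) c (l ++ nseq (ordc c) iv) = 0.
  by move=> sl; rewrite (jcoord_jetof oU sU c Up sl) partials_cat (H c (size l)).
split; first by rewrite (jval_jetof oU sU _ Up).
- by move=> c l; rewrite !inE => /or3P[]/eqP->; [exact: (Z ch11)|exact: (Z ch12)|exact: (Z ch22)].
- by move=> c l; rewrite !inE => /orP[]/eqP->; [exact: (Z cW1)|exact: (Z cW2)].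
- exact: (Z cH).
Qed.

End Components.
End FieldEquations.

(** * Maps of the pseudogroup and their inverses *)

Section PseudogroupMaps.
Context {R : realType}.
Implicit Types (s : 'rV[R]_4 -> 'rV[R]_6) (phi psi : 'rV[R]_4 -> 'rV[R]_4) (U : set 'rV[R]_4).
Implicit Types (p z : 'rV[R]_4) (a b c d i j : 'I_4).

Notation e i := (delta_mx 0 i : 'rV[R]_4).

(** The line through [z] in direction [i] stays in the open set [U] near [z], so the difference
    quotient is zero for small increments. *)
Lemma partial_indep U (f : 'rV[R]_4 -> R) i z : open U -> U z ->
  (forall w, U w -> (forall j, j != i -> w 0 j = z 0 j) -> f w = f z) -> partial i f z = 0.
Proof.
move=> oU Uz H; rewrite /partial /derive; apply: lim_near_cst => //.
have C : {for (0 : R), continuous (fun h : R => h *: e i + z)}.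
  by apply: continuousD; [exact: scalel_continuous|exact: cst_continuous].
have N0 : \forall h \near (0 : R), U (h *: e i + z).
  apply: C; rewrite scale0r add0r; exact: open_nbhs_nbhs.
have := nbhs_dnbhs N0.
apply: filterS => h Uh /=.
rewrite (H _ Uh) ?subrr ?scaler0 // => j ji.
by rewrite !mxE (negPf ji) andbF mulr0 add0r.
Qed.

Lemma smooth_on_differentiable U phi z : smooth_on U phi -> U z -> differentiable phi z.
Proof. by move=> sp Uz; apply: differentiable_mx => k j; rewrite ord1; apply: (sp j [::]). Qed.

Lemma diff_jac U phi z (X : 'rV[R]_4) c : smooth_on U phi -> U z ->
  ('d phi z X) 0 c = \sum_i X 0 i * jac phi i c z.
Proof.
move=> sp Uz; rewrite -deriveE; last exact: smooth_on_differentiable Uz.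
rewrite derive_mxE; last by move=> k j; rewrite ord1; apply: (sp j [::]).
by rewrite mxE derive_partial //; apply: (sp c [::]).
Qed.

Lemma diff_delta U phi z i c : smooth_on U phi -> U z -> ('d phi z (e i)) 0 c = jac phi i c z.
Proof.
move=> sp Uz; rewrite (diff_jac _ _ sp Uz) (bigD1 i) //= big1 ?addr0.
  by rewrite !mxE !eqxx mul1r.
by move=> j ji; rewrite !mxE (negPf ji) andbF mul0r.
Qed.

Lemma gc_transport U phi s s' a b z : smooth_on U phi -> U z ->
  (forall X Y, kundt (s z) X Y = kundt (s' (phi z)) ('d phi z X) ('d phi z Y)) ->
  gc s a b z = \sum_c \sum_d gc s' c d (phi z) * jac phi a c z * jac phi b d z.
Proof.
move=> sp Uz H; rewrite /gc H kundt_sum.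
apply: eq_bigr => c _; apply: eq_bigr => d _.
by rewrite !(diff_delta _ _ sp Uz) -[RHS]mulrA [RHS]mulrC.
Qed.

(** The normal form enters through the coordinates on which each component depends, which gives the
    zero entries of the Jacobian. The reciprocity of [J iu iu] and [J iv iv] is recovered from the
    metric in [jac_uv1]. *)
Lemma kmap_of_pseudogroup U phi s s' : pseudogroup U phi -> carries U phi s s' ->
  kmap U (phi @` U) phi (jac phi) s s'.
Proof.
move=> [oU oU' sphi _ [C [A1 [A2 [B H]]]]] [[ss _] [ss' _] T].
have ind i c z : U z ->
  (forall w, U w -> (forall j, j != i -> w 0 j = z 0 j) -> phi w 0 c = phi z 0 c) ->
  jac phi i c z = 0.
  by move=> Uz; apply: partial_indep.
split=> //.
- move=> c z Uz; elim/ord4_ind: c => // _; apply: ind => // w Uw E;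
  have [uz z1 z2 _ _] := H z Uz; have [uw w1 w2 _ _] := H w Uw.
  + by rewrite uz uw E.
  + by rewrite z1 w1 !E.
  + by rewrite z2 w2 !E.
- move=> z Uz; apply: ind => // w Uw E.
  by have [-> _ _ _ _] := H z Uz; have [-> _ _ _ _] := H w Uw; rewrite E.
- move=> z Uz; apply: ind => // w Uw E.
  by have [-> _ _ _ _] := H z Uz; have [-> _ _ _ _] := H w Uw; rewrite E.
- by move=> a b z Uz; exact: (gc_transport a b sphi Uz (T z Uz)).
Qed.

Lemma sum_inverse (X : 'I_4 -> R) (A : 'I_4 -> 'I_4 -> R) (B : 'I_4 -> R) k :
  (forall i, \sum_j A i j * B j = (i == k)%:R) -> \sum_j (\sum_i X i * A i j) * B j = X k.
Proof.
move=> H; under eq_bigr => j _ do rewrite mulr_suml.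
rewrite exchange_big /=; under eq_bigr => i _.
  under eq_bigr => j _ do rewrite -mulrA.
  rewrite -mulr_sumr H; over.
by rewrite (bigD1 k) //= eqxx mulr1 big1 ?addr0 // => i /negPf ->; rewrite mulr0.
Qed.

(** Row v of A P = 1 clears row v of P. Then the (x^1, x^2) blocks of A and P are inverse to each
    other, so that of A has nonzero determinant; being injective, it forces the x-entries of column
    u of P to vanish. *)
Lemma block_inverse (A P : 'I_4 -> 'I_4 -> R) :
  (forall i k, \sum_j A i j * P j k = (i == k)%:R) ->
  (forall c, c != iv -> A iv c = 0) -> A iv iv != 0 -> A ix1 iu = 0 -> A ix2 iu = 0 ->
  [/\ A ix1 ix1 * A ix2 ix2 - A ix1 ix2 * A ix2 ix1 != 0,
     forall c, c != iv -> P iv c = 0, P ix1 iu = 0 & P ix2 iu = 0].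
Proof.
move=> E Av vv u1 u2.
have V c : c != iv -> P iv c = 0.
  move=> cv; have /negPf cv' : iv != c by rewrite eq_sym.
  have := E iv c; rewrite cv' sum4 (Av iu isT) (Av ix1 isT) (Av ix2 isT) !mul0r !add0r => /eqP.
  by rewrite mulf_eq0 (negPf vv) => /eqP.
have := E ix1 ix1; have := E ix1 ix2; have := E ix2 ix1; have := E ix2 ix2.
have := E ix1 iu; have := E ix2 iu.
rewrite !sum4 !V // u1 u2 /=.
move: (A ix1 ix1) (A ix1 ix2) (A ix2 ix1) (A ix2 ix2) (A ix1 iv) (A ix2 iv).
move: (P ix1 ix1) (P ix1 ix2) (P ix2 ix1) (P ix2 ix2) (P ix1 iu) (P ix2 iu).
move=> y11 y12 y21 y22 y1 y2 x11 x12 x21 x22 m1 m2 E2 E1 E22 E21 E12 E11.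
have D0 : x11 * x22 - x12 * x21 != 0.
  apply/negP => /eqP D0.
  have : (x11 * x22 - x12 * x21) * (y11 * y22 - y12 * y21) = 1.
    have -> : (x11 * x22 - x12 * x21) * (y11 * y22 - y12 * y21) =
      (x11 * y11 + x12 * y21) * (x21 * y12 + x22 * y22) -
      (x11 * y12 + x12 * y22) * (x21 * y11 + x22 * y21) by ring.
    have -> : x11 * y11 + x12 * y21 = 1 by lra.
    have -> : x21 * y12 + x22 * y22 = 1 by lra.
    have -> : x11 * y12 + x12 * y22 = 0 by lra.
    by rewrite mul0r mulr1 subr0.
  by rewrite D0 mul0r => /eqP; rewrite eq_sym oner_eq0.
have F1 : x11 * y1 + x12 * y2 = 0 by lra.
have F2 : x21 * y1 + x22 * y2 = 0 by lra.
split=> //; apply: (mulfI D0); rewrite mulr0.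
  transitivity (x22 * (x11 * y1 + x12 * y2) - x12 * (x21 * y1 + x22 * y2)); first by ring.
  by rewrite F1 F2 !mulr0 subr0.
transitivity (x11 * (x21 * y1 + x22 * y2) - x21 * (x11 * y1 + x12 * y2)); first by ring.
by rewrite F1 F2 !mulr0 subr0.
Qed.

Section Inverse.
Context U U' phi psi s s' (K : kmap U U' phi (jac phi) s s').
Context (spsi : smooth_on U' psi) (psiK : forall z, U z -> psi (phi z) = z).
Context (onto : forall w, U' w -> exists2 z, U z & phi z = w).

Lemma jac_inverse z i k : U z ->
  \sum_j jac phi i j z * jac psi j k (phi z) = (i == k)%:R.
Proof.
move=> Uz; have oU := km_oU K.
have E w : U w -> psi (phi w) 0 k = w 0 k by move=> Uw; rewrite psiK.
have := partial_eq i oU E Uz.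
rewrite [LHS](@partial_comp _ (fun w => psi w 0 k)); first last.
- by apply: (spsi k [::]); exact: km_map K _ Uz.
- by move=> j; apply: (km_phi K j [::]).
move=> E'; rewrite -[RHS](_ : partial i (fun w : 'rV[R]_4 => w 0 k) z = _).
  by rewrite -E'; apply: eq_bigr => j _; rewrite mulrC.
have dc (m j : 'I__) : differentiable (fun w : 'rV[R]_4 => w m j) z by exact: differentiable_coord.
have := derive_mxE (M := fun w : 'rV[R]_4 => w) (e i) dc.
rewrite [LHS]derive_id => /rowP/(_ k); rewrite !mxE eqxx /= eq_sym => ->.
by [].
Qed.

(** [psi] is given as a left inverse of [phi]; for the square Jacobian matrices, a one-sided inverse
    is two-sided. *)
Lemma diff_inverse' z Y : U z -> 'd phi z ('d psi (phi z) Y) = Y.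
Proof.
move=> Uz; have U'z := km_map K Uz.
have M : (\matrix_(i, j) jac phi i j z) *m (\matrix_(j, k) jac psi j k (phi z)) = 1%:M.
  apply/matrixP => i k; rewrite !mxE -(jac_inverse i k Uz).
  by apply: eq_bigr => j _; rewrite !mxE.
have /matrixP M' := mulmx1C M.
apply/rowP => k; rewrite (diff_jac _ _ (km_phi K) Uz).
under eq_bigr => j _ do rewrite (diff_jac _ _ spsi U'z).
apply: sum_inverse => i.
by have := M' i k; rewrite !mxE => <-; apply: eq_bigr => j _; rewrite !mxE.
Qed.

Lemma jac_block z : U z ->
  [/\ jac phi ix1 ix1 z * jac phi ix2 ix2 z - jac phi ix1 ix2 z * jac phi ix2 ix1 z != 0,
     forall c, c != iv -> jac psi iv c (phi z) = 0,
     jac psi ix1 iu (phi z) = 0 & jac psi ix2 iu (phi z) = 0].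
Proof.
move=> Uz.
apply: (@block_inverse (fun i j => jac phi i j z) (fun j k => jac psi j k (phi z))).
- by move=> i k; apply: jac_inverse.
- by move=> c; apply: (km_v K Uz).
- exact: (jac_vv_neq0 K Uz).
- exact: (km_x1 K Uz).
- exact: (km_x2 K Uz).
Qed.

Lemma kmap_inverse :
  (forall z, U z -> forall X Y, kundt (s z) X Y = kundt (s' (phi z)) ('d phi z X) ('d phi z Y)) ->
  kmap U' U psi (jac psi) s' s.
Proof.
move=> T.
split=> //.
- exact: km_oU' K.
- exact: km_oU K.
- by move=> w /onto[z Uz <-]; rewrite psiK.
- exact: km_s' K.
- exact: km_s K.
- by move=> c w /onto[z Uz <-]; have [_ V _ _] := jac_block Uz; apply: V.
- by move=> w /onto[z Uz <-]; have [_ _ V _] := jac_block Uz; apply: V.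
- by move=> w /onto[z Uz <-]; have [_ _ _ V] := jac_block Uz; apply: V.
- move=> a b w Uw; apply: (gc_transport a b spsi Uw).
  have /onto[z Uz <-] := Uw => X Y.
  have H := etrans (T z Uz ('d psi (phi z) X) ('d psi (phi z) Y))
    (f_equal2 (kundt (s' (phi z))) (diff_inverse' X Uz) (diff_inverse' Y Uz)).
  exact: (etrans (esym H) (f_equal (fun q => kundt (s q) _ _) (esym (psiK Uz)))).
Qed.

End Inverse.
End PseudogroupMaps.

(** * Transformation of the scalar invariants *)

Section InvariantFunctions.
Context {R : realType}.
Implicit Types (s : 'rV[R]_4 -> 'rV[R]_6) (phi psi : 'rV[R]_4 -> 'rV[R]_4) (U : set 'rV[R]_4).
Implicit Types (p z : 'rV[R]_4) (a b c d i j k : 'I_4).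

(** The factor 2 undoes G_uj = W_j / 2, so for j = x^1, x^2 this is (W_j)_v. *)
Definition Wv s j (z : 'rV[R]_4) : R := 2 * dv 1 (gc s iu j) z.

Definition Hvv s : 'rV[R]_4 -> R := dv 2 (gc s iu iu).

Definition curlW s (z : 'rV[R]_4) : R := partial ix2 (Wv s ix1) z - partial ix1 (Wv s ix2) z.

Definition detg s (z : 'rV[R]_4) : R :=
  gc s ix1 ix1 z * gc s ix2 ix2 z - gc s ix1 ix2 z ^+ 2.

Definition normW s (z : 'rV[R]_4) : R :=
  Wv s ix1 z ^+ 2 * gc s ix2 ix2 z - 2 * Wv s ix1 z * Wv s ix2 z * gc s ix1 ix2 z
  + Wv s ix2 z ^+ 2 * gc s ix1 ix1 z.

Lemma smooth_sqr U (f : 'rV[R]_4 -> R) : open U -> smooth U f -> smooth U (fun w => f w ^+ 2).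
Proof. by move=> oU sf; under eq_fun do rewrite expr2; apply: smoothM. Qed.

Lemma smoothN U (f : 'rV[R]_4 -> R) : open U -> smooth U f -> smooth U (fun w => - f w).
Proof.
move=> oU sf; under eq_fun do rewrite -mulN1r.
by apply: smoothM => //; exact: smooth_cst.
Qed.

Lemma flatN U N p (f : 'rV[R]_4 -> R) : open U -> U p -> smooth U f ->
  flat N p f -> flat N p (fun w => - f w).
Proof.
move=> oU Up sf Ff; under eq_fun do rewrite -mulN1r.
by apply: (flatMr oU Up _ sf Ff); exact: smooth_cst.
Qed.

Section SmoothInvariants.
Context U s (oU : open U) (sU : smooth_on U s).

Lemma smooth_Wv j : smooth U (Wv s j).
Proof.
apply: smoothM => //; first exact: smooth_cst.
by apply: smooth_dv; exact: smooth_gc.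
Qed.

Lemma smooth_curlW : smooth U (curlW s).
Proof.
apply: smoothD => //; last apply: smoothN => //;
by apply: smooth_partial; exact: smooth_Wv.
Qed.

Lemma smooth_detg : smooth U (detg s).
Proof.
apply: smoothD => //; first by apply: smoothM => //; exact: smooth_gc.
by apply: smoothN => //; apply: smooth_sqr => //; exact: smooth_gc.
Qed.

End SmoothInvariants.

Lemma sum_but_u (T : 'I_4 -> 'I_4 -> R) :
  \sum_c \sum_d T c d = \sum_d T iu d + \sum_c \sum_d (if c == iu then 0 else T c d).
Proof. by rewrite !sum4 /=; ring. Qed.

Lemma sum_but_uu (T : 'I_4 -> 'I_4 -> R) :
  \sum_c \sum_d T c d =
  T iu iu + \sum_c \sum_d (if (c == iu) && (d == iu) then 0 else T c d).
Proof. by rewrite !sum4 /=; ring. Qed.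

Section OneMap.
Context U U' phi J s s' (K : kmap U U' phi J s s') p (Up : U p).
Context (Q : kundt_eqs s' (phi p)).

Let oU : open U := km_oU K.
Let oU' : open U' := km_oU' K.
Let sJ : forall a c, smooth U (J a c) := smooth_J K.

(** The error terms, at the point p of the section. They form an ideal of the smooth functions,
    closed under partial derivatives, and the invariants transform as expected modulo it. *)
Definition negligible (F : 'rV[R]_4 -> R) := smooth U F /\ forall N, flat N p F.

Lemma negligible0 : negligible (fun=> 0).
Proof. by split; [exact: smooth_cst|move=> N; exact: flat0]. Qed.

Lemma negligibleD F G : negligible F -> negligible G -> negligible (fun z => F z + G z).
Proof.
move=> [sF fF] [sG fG]; split; first exact: smoothD.
by move=> N; apply: (flatD oU Up sF sG).
Qed.

Lemma negligibleM F G : smooth U F -> negligible G -> negligible (fun z => F z * G z).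
Proof.
move=> sF [sG fG]; split; first exact: smoothM.
by move=> N; apply: (flatMr oU Up sF sG).
Qed.

Lemma negligibleN F : negligible F -> negligible (fun z => - F z).
Proof.
by move=> [sF fF]; split; [exact: smoothN|move=> N; exact: (flatN oU Up sF)].
Qed.

Lemma negligible_eq F G : (forall z, U z -> F z = G z) -> negligible F -> negligible G.
Proof.
move=> E [sF fF]; split; first exact: smooth_eq sF.
by move=> N; apply: (flat_eq oU Up E).
Qed.

Lemma negligible_sum (T : 'I_4 -> 'rV[R]_4 -> R) :
  (forall d, negligible (T d)) -> negligible (fun z => \sum_d T d z).
Proof.
move=> H; split; first by apply: smooth_sum => // d; case: (H d).
by move=> N; apply: (flat_sum _ oU Up) => d; case: (H d).
Qed.

Lemma negligible_partial F i : negligible F -> negligible (partial i F).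
Proof. by move=> [sF fF]; split; [exact: smooth_partial|move=> N; exact: flat_partial]. Qed.

Lemma negligible_pull f : smooth U' f -> (forall N, flat N (phi p) f) ->
  negligible (fun z => f (phi z)).
Proof.
move=> sf ff; split; first exact: (smooth_pull K).
by move=> N; apply: (flat_comp oU Up (km_map K) (km_phi K) sf).
Qed.

Lemma negligible_dv n c d : (wt c + wt d <= n)%N ->
  negligible (fun z => dv n.+1 (gc s' c d) (phi z)).
Proof.
move=> le; apply: negligible_pull; first by apply/smooth_dv/(smooth_G' K).
move=> N; rewrite (_ : n.+1 = (n - (wt c + wt d)) + (wt c + wt d).+1)%N; last by rewrite addnS subnK.
by rewrite dvD; apply: flat_dv.
Qed.

Lemma negligible_term n a b c d : (wt c + wt d <= n)%N ->
  negligible (fun z => dv n.+1 (gc s' c d) (phi z) * J a c z * J b d z).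
Proof.
move=> le; have E z : U z -> (J a c z * J b d z) * dv n.+1 (gc s' c d) (phi z) =
   dv n.+1 (gc s' c d) (phi z) * J a c z * J b d z by move=> _; rewrite mulrC mulrA.
by apply: (negligible_eq E); apply: negligibleM; [exact: smoothM|exact: negligible_dv].
Qed.

(** Modulo error terms W_v is a covector in the x-directions: terms with c other than u fall under
    the Kundt equations, and those with c = u carry the factor [J iv iv * J iu iu], which is 1. *)
Lemma Wv_transform j : j != iu -> exists2 F, negligible F &
  forall z, U z ->
    Wv s j z = Wv s' ix1 (phi z) * J j ix1 z + Wv s' ix2 (phi z) * J j ix2 z + F z.
Proof.
move=> ju.
pose F z := (2 * J iv iv z) * \sum_c \sum_d
  (if c == iu then 0 else dv 1 (gc s' c d) (phi z) * J iu c z * J j d z).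
exists F.
  apply: negligibleM; first by apply: smoothM => //; exact: smooth_cst.
  apply: negligible_sum => c; apply: negligible_sum => d.
  case: (eqVneq c iu) => [_|cu]; first exact: negligible0.
  case: (eqVneq d iu) => [->|du]; last first.
    by apply: negligible_term; rewrite /wt (negPf cu) (negPf du).
  have Z z : U z -> 0 = dv 1 (gc s' c iu) (phi z) * J iu c z * J j iu z.
    by move=> Uz; rewrite (jac_u0 K Uz ju) mulr0.
  exact: (negligible_eq Z negligible0).
move=> z Uz; rewrite /Wv (dv_G K) // (kappa0 K) ?ju ?orbT // mulr0 addr0 expr1.
rewrite sum_but_u sum4 (jac_u0 K Uz ju) (dv_gcv s' 0 iu) /F.
have := jac_uv1 K Uz.
move: (J iv iv z) (J iu iu z) (J j ix1 z) (J j ix2 z) (J j iv z) => x0 x1 x2 x3 x4.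
move: (\sum_c _) (dv 1 _ _) (dv 1 _ _) (dv 1 _ _) => y1 y2 y3 y4 E.
have -> : 2 * (x0 * (y4 * x1 * 0 + y3 * x1 * x2 + y2 * x1 * x3 + 0 * x1 * x4 + y1)) =
  2 * (x1 * x0) * (y3 * x2 + y2 * x3) + 2 * x0 * y1 by ring.
by rewrite E; ring.
Qed.

(** For two v-derivatives [kappa] is absent, the (u, u) term carries the square of
    [J iv iv * J iu iu], which is 1, and every other pair has weight at most 1. *)
Lemma Hvv_transform : exists2 F, negligible F &
  forall z, U z -> Hvv s z = Hvv s' (phi z) + F z.
Proof.
pose F z := J iv iv z ^+ 2 * \sum_c \sum_d
  (if (c == iu) && (d == iu) then 0 else dv 2 (gc s' c d) (phi z) * J iu c z * J iu d z).
exists F.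
  apply: negligibleM; first exact: smooth_sqr.
  apply: negligible_sum => c; apply: negligible_sum => d.
  case: (boolP ((c == iu) && (d == iu))) => [_|cd]; first exact: negligible0.
  by apply: negligible_term; move: cd; rewrite /wt; do 2!case: (_ == _).
move=> z Uz; rewrite /Hvv (dv_G K) // mul0r addr0 sum_but_uu /F.
have := jac_uv1 K Uz.
move: (J iv iv z) (J iu iu z) (\sum_c _) (dv 2 _ _) => x0 x1 y1 y2 E.
have -> : x0 ^+ 2 * (y2 * x1 * x1 + y1) = y2 * (x1 * x0) ^+ 2 + x0 ^+ 2 * y1 by ring.
by rewrite E expr1n mulr1.
Qed.

Lemma gc_transform j k z : U z -> j != iu -> k != iu ->
  gc s j k z = gc s' ix1 ix1 (phi z) * J j ix1 z * J k ix1 z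
  + gc s' ix1 ix2 (phi z) * (J j ix1 z * J k ix2 z + J j ix2 z * J k ix1 z)
  + gc s' ix2 ix2 (phi z) * J j ix2 z * J k ix2 z.
Proof.
move=> Uz ju ku; rewrite (km_T K) // !sum4 (jac_u0 K Uz ju) (jac_u0 K Uz ku).
rewrite !gcv !(gcC _ iv) !gcv (gcC _ ix2 ix1) /=.
move: (gc s' ix1 ix1 _) (gc s' ix1 ix2 _) (gc s' ix2 ix2 _).
move: (gc s' iu iu _) (gc s' iu ix1 _) (gc s' iu ix2 _) (gc s' ix1 iu _) (gc s' ix2 iu _).
move: (J j _ z) (J j _ z) (J j _ z) (J k _ z) (J k _ z) (J k _ z) => *; ring.
Qed.

Lemma partial_pull_x f k z : smooth U' f -> U z -> k != iu ->
  partial k (fun w => f (phi w)) z = partial ix1 f (phi z) * J k ix1 z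
    + partial ix2 f (phi z) * J k ix2 z + partial iv f (phi z) * J k iv z.
Proof.
move=> sf Uz ku; apply: (etrans (partial_pull K k sf Uz)); apply: (etrans (sum4 _)).
rewrite (jac_u0 K Uz ku); move: (partial iu _ _) => x.
by congr (_ + _ + _); rewrite mulr0 add0r.
Qed.

Definition jdet z : R := J ix1 ix1 z * J ix2 ix2 z - J ix1 ix2 z * J ix2 ix1 z.

Lemma smooth_jdet : smooth U jdet.
Proof. by apply: smoothD => //; last apply: smoothN => //; apply: smoothM. Qed.

Lemma detg_transform z : U z -> detg s z = jdet z ^+ 2 * detg s' (phi z).
Proof.
move=> Uz; rewrite /detg !(gc_transform Uz) // /jdet.
move: (gc s' _ _ _) (gc s' _ _ _) (gc s' _ _ _) (J _ _ z) (J _ _ z) (J _ _ z) (J _ _ z) => *; ring.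
Qed.

(** The numerator of I_1 is the adjugate of h evaluated on the covector W_v; when h and W_v are both
    pulled back, it scales by the square of the Jacobian determinant in x. *)
Lemma normW_transform : exists2 F, negligible F &
  forall z, U z -> normW s z = jdet z ^+ 2 * normW s' (phi z) + F z.
Proof.
have [F1 n1 E1] := Wv_transform (isT : ix1 != iu).
have [F2 n2 E2] := Wv_transform (isT : ix2 != iu).
have sW j : smooth U (Wv s j) := smooth_Wv oU (km_s K) j.
have sg a b : smooth U (gc s a b) := smooth_G K a b.
have [sF1 _] := n1; have [sF2 _] := n2.
(* [normW] at W_v minus its value at W_v - (F1, F2), arranged so that every term has a factor [F1]
   or [F2]. *)
pose F z := ((Wv s ix1 z + Wv s ix1 z - F1 z) * gc s ix2 ix2 z) * F1 z
  + ((2 * (F1 z - Wv s ix1 z)) * gc s ix1 ix2 z) * F2 z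
  - (2 * Wv s ix2 z * gc s ix1 ix2 z) * F1 z
  + ((Wv s ix2 z + Wv s ix2 z - F2 z) * gc s ix1 ix1 z) * F2 z.
exists F.
  apply: negligibleD; [apply: negligibleD; [apply: negligibleD|]|];
    [apply: negligibleM n1|apply: negligibleM n2|apply: negligibleN; apply: negligibleM n1
     |apply: negligibleM n2];
  repeat first [exact: sW | exact: sg | exact: sF1 | exact: sF2 | exact: smooth_cst
    | apply: smoothM; first exact: oU | apply: smoothD; first exact: oU
    | apply: smoothN; first exact: oU ].
move=> z Uz; rewrite /F /normW E1 // E2 // !(gc_transform Uz) // /jdet.
move: (gc s' _ _ _) (gc s' _ _ _) (gc s' _ _ _) (J _ _ z) (J _ _ z) (J _ _ z) (J _ _ z).
move: (Wv _ _ _) (Wv _ _ _) (F1 z) (F2 z) => *; ring.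
Qed.

Lemma partial_v_Wv' j : j != iu -> negligible (fun z => partial iv (Wv s' j) (phi z)).
Proof.
move=> ju; have Z z : U z -> 2 * dv 2 (gc s' iu j) (phi z) = partial iv (Wv s' j) (phi z).
  move=> Uz; rewrite /Wv partialM; [|exact: differentiable_cst|].
    by rewrite partial_cst mul0r add0r.
  by have := smooth_dv 1 (smooth_G' K iu j); move/(_ [::] _ (km_map K Uz)).
apply: (negligible_eq Z); apply: negligibleM; first exact: smooth_cst.
by apply: negligible_dv; rewrite /wt (negPf ju).
Qed.

(** An exterior derivative commutes with pullback: the mixed second derivatives of [phi] cancel by
    [jac_comm], and the remaining 2-form coefficient scales by [jdet]. *)
Lemma curlW_transform : exists2 F, negligible F &
  forall z, U z -> curlW s z = jdet z * curlW s' (phi z) + F z.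
Proof.
have [F1 n1 E1] := Wv_transform (isT : ix1 != iu).
have [F2 n2 E2] := Wv_transform (isT : ix2 != iu).
have sW' j : smooth U' (Wv s' j) := smooth_Wv oU' (km_s' K) j.
have sP j : smooth U (fun z => Wv s' j (phi z)) := smooth_pull K (sW' j).
have [sF1 _] := n1; have [sF2 _] := n2.
pose V j z := partial iv (Wv s' j) (phi z).
(* The terms in [V] arise because the v-component of [phi] depends on x; they contain W_vv of the
   image metric and are thus negligible. The last two differentiate the errors in W_v. *)
pose F z := (J ix1 ix1 z * J ix2 iv z - J ix2 ix1 z * J ix1 iv z) * V ix1 z
  + (J ix1 ix2 z * J ix2 iv z - J ix2 ix2 z * J ix1 iv z) * V ix2 z
  + partial ix2 F1 z - partial ix1 F2 z.
have sm a b c d : smooth U (fun z => J a b z * J c d z - J a c z * J b d z).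
  by apply: smoothD => //; last apply: smoothN => //; apply: smoothM.
exists F.
  apply: negligibleD; [apply: negligibleD; [apply: negligibleD|]|].
  - apply: negligibleM (partial_v_Wv' (isT : ix1 != iu)).
    by apply: smoothD => //; last apply: smoothN => //; apply: smoothM.
  - apply: negligibleM (partial_v_Wv' (isT : ix2 != iu)).
    by apply: smoothD => //; last apply: smoothN => //; apply: smoothM.
  - exact: negligible_partial.
  - by apply: negligibleN; exact: negligible_partial.
move=> z Uz.
have D j k Fj : j != iu -> k != iu -> smooth U Fj ->
  partial k (fun z => Wv s' ix1 (phi z) * J j ix1 z + Wv s' ix2 (phi z) * J j ix2 z + Fj z) z =
  (partial ix1 (Wv s' ix1) (phi z) * J k ix1 z + partial ix2 (Wv s' ix1) (phi z) * J k ix2 z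
    + V ix1 z * J k iv z) * J j ix1 z + Wv s' ix1 (phi z) * partial k (J j ix1) z +
  ((partial ix1 (Wv s' ix2) (phi z) * J k ix1 z + partial ix2 (Wv s' ix2) (phi z) * J k ix2 z
    + V ix2 z * J k iv z) * J j ix2 z + Wv s' ix2 (phi z) * partial k (J j ix2) z)
  + partial k Fj z.
  move=> ju ku sFj.
  have dP i : differentiable (fun z => Wv s' i (phi z)) z by exact: (sP i [::]).
  have dJ a c : differentiable (J a c) z by exact: (sJ a c [::]).
  rewrite partialD; [|by apply: differentiableD; exact: differentiableM|exact: (sFj [::])].
  rewrite partialD; [|exact: differentiableM|exact: differentiableM].
  rewrite (partialM k (dP ix1) (dJ j ix1)) (partialM k (dP ix2) (dJ j ix2)).
  by rewrite (partial_pull_x (sW' ix1) Uz ku) (partial_pull_x (sW' ix2) Uz ku).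
rewrite {1}/curlW (partial_eq ix2 oU E1 Uz) (partial_eq ix1 oU E2 Uz).
rewrite (D ix1 ix2 F1) // (D ix2 ix1 F2) // (jac_comm K ix1 ix2 ix1 Uz) (jac_comm K ix1 ix2 ix2 Uz).
rewrite /F /jdet /curlW.
move: (partial ix2 F1 z) (partial ix1 F2 z) (V ix1 z) (V ix2 z).
move: (partial ix2 (J _ _) z) (partial ix2 (J _ _) z).
move: (partial _ (Wv _ _) _) (partial _ (Wv _ _) _) (partial _ (Wv _ _) _) (partial _ (Wv _ _) _).
move: (Wv _ _ _) (Wv _ _ _).
move: (J ix1 ix1 z) (J ix1 ix2 z) (J ix2 ix1 z) (J ix2 ix2 z) (J ix1 iv z) (J ix2 iv z) => *; ring.
Qed.

Lemma partial_negligible_quotient F D i : negligible F -> smooth U D -> D p != 0 ->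
  differentiable (fun z => F z / D z) p /\ partial i (fun z => F z / D z) p = 0.
Proof.
move=> [sF fF] sD D0.
have dF : differentiable F p by exact: (sF [::]).
have dV : differentiable (fun z => (D z)^-1) p by apply: differentiableV => //; exact: (sD [::]).
split; first exact: differentiableM.
rewrite partialM //.
by have /= -> := fF 1%N [:: i] isT; have /= -> := fF 0%N [::] isT; rewrite !mul0r addr0.
Qed.

End OneMap.
End InvariantFunctions.

(** * Invariance of the differentials *)

Section Transport.
Context {R : realType}.
Implicit Types (s : 'rV[R]_4 -> 'rV[R]_6) (phi psi : 'rV[R]_4 -> 'rV[R]_4) (U : set 'rV[R]_4).
Implicit Types (p z : 'rV[R]_4) (a b c d i j k : 'I_4).

Notation e i := (delta_mx 0 i : 'rV[R]_4).

Lemma hvec_delta n i (th : jet R n.+1) : hvec (e i) th = Dvec i th.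
Proof.
rewrite /hvec (bigD1 i) //= big1 ?addr0.
  by rewrite mxE !eqxx scale1r.
by move=> j ji; rewrite mxE (negPf ji) andbF scale0r.
Qed.

Lemma Dtot_jetof U s p i (f : jet R 2 -> R) : open U -> smooth_on U s -> U p ->
  differentiable f (jetof 2 s p) ->
  Dtot i f (jetof 3 s p) = partial i (fun z => f (jetof 2 s z)) p.
Proof.
move=> oU sU Up df; have dj : differentiable (jetof 2 s) p := jetof_differentiable sU 2 Up.
rewrite /Dtot (trunc_jetof oU sU 2 Up) /partial.
rewrite [RHS](deriveE _ (differentiable_comp dj df)) (diff_comp dj df) /=.
have Ej : 'D_(e i) (jetof 2 s) p = Dvec i (jetof 3 s p).
  by rewrite -hvec_delta; exact: (derive_jetof oU sU 2 (e i) Up).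
by rewrite -(deriveE _ dj) Ej deriveE.
Qed.

Section Evaluation.
Context U s (oU : open U) (sU : smooth_on U s).

Lemma Wv_jetof j (c : 'I_6) z : (forall y : 'rV[R]_6, kundt y (e iu) (e j) = y 0 c / 2) -> U z ->
  Wv s j z = partial iv (fun w => s w 0 c) z.
Proof.
move=> E Uz; rewrite /Wv (_ : gc s iu j = fun w => 2^-1 * s w 0 c); last first.
  by apply/funext => w; rewrite /gc E mulrC.
rewrite [dv 1 _ z](partials_scale _ [:: iv] oU (sU c) Uz) mulrA divff ?mul1r //.
Qed.

Lemma detg_jetof z : U z -> deth (jetof 2 s z) = detg s z.
Proof.
by move=> Uz; rewrite /deth !(jcoord_jetof oU sU) // /detg /gc kundt_11 kundt_12 kundt_22.
Qed.

Lemma I1_jetof z : U z -> I1 (jetof 2 s z) = normW s z / detg s z.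
Proof.
move=> Uz; rewrite /I1 !(jcoord_jetof oU sU) //= /detg /normW.
rewrite (Wv_jetof (@kundt_u1 R)) // (Wv_jetof (@kundt_u2 R)) //.
by rewrite /gc kundt_11 kundt_12 kundt_22.
Qed.

Lemma I2a_jetof z : U z -> I2a (jetof 2 s z) = Hvv s z.
Proof.
move=> Uz; have -> : Hvv s = partials [:: iv; iv] (fun w => s w 0 cH).
  by rewrite /Hvv /dv; congr partials; apply/funext => w; rewrite /gc kundt_uu.
exact: (jcoord_jetof oU sU cH Uz).
Qed.

Lemma I2b_jetof z : U z -> I2b (jetof 2 s z) = curlW s z ^+ 2 / detg s z.
Proof.
move=> Uz; rewrite /I2b !(jcoord_jetof oU sU) //= /detg /curlW.
have E1 w : U w -> Wv s ix1 w = partial iv (fun w => s w 0 cW1) w.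
  exact: (Wv_jetof (@kundt_u1 R)).
have E2 w : U w -> Wv s ix2 w = partial iv (fun w => s w 0 cW2) w.
  exact: (Wv_jetof (@kundt_u2 R)).
rewrite (partial_eq ix2 oU E1 Uz) (partial_eq ix1 oU E2 Uz).
by rewrite /gc kundt_11 kundt_12 kundt_22.
Qed.

End Evaluation.

Lemma quotient_transform (m d N D N' D' F : R) : D = d ^+ 2 * D' -> D != 0 ->
  N = d ^+ 2 * N' + F -> N / D = N' / D' + F / D.
Proof.
move=> ED D0 ->; rewrite mulrDl; congr (_ + _); rewrite ED in D0 *.
move: D0; rewrite mulf_eq0 negb_or expf_eq0 /= => /andP[d0 D'0].
by field; rewrite d0 D'0.
Qed.

Section Action.
Context U phi s s' p (G : pseudogroup U phi) (C : carries U phi s s') (Up : U p).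
Context (E : forall n, Etilde (jetof n s p)).

Let K : kmap U (phi @` U) phi (jac phi) s s' := kmap_of_pseudogroup G C.
Let U'p : (phi @` U) (phi p) := km_map K Up.

Lemma inverse_exists : exists psi, [/\ smooth_on (phi @` U) psi, forall z, U z -> psi (phi z) = z
  & kmap (phi @` U) U psi (jac psi) s' s].
Proof.
have [_ _ _ [psi spsi psiK] _] := G; have [_ _ T] := C.
exists psi; split=> //.
by apply: (kmap_inverse K spsi psiK _ T) => w [z Uz <-]; exists z.
Qed.

Lemma kundt_eqs_image : kundt_eqs s' (phi p).
Proof.
have [psi [_ psiK K']] := inverse_exists.
apply: (kundt_eqs_transfer K' U'p); rewrite (psiK _ Up).
apply: (kundt_eqs_of_components (km_oU K) (km_s K) Up).
exact: (components_of_Etilde (km_oU K) (km_s K) Up E).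
Qed.

Lemma Etilde_image n : Etilde (jetof n s' (phi p)).
Proof.
have [_ [_ pd] _] := C.
apply: (Etilde_of_components (km_oU' K) (km_s' K) U'p); first exact: pd.
exact: (components_of_kundt_eqs (km_oU' K) (km_s' K) U'p kundt_eqs_image).
Qed.

Lemma detg_gt0 z : U z -> 0 < detg s z.
Proof.
move=> Uz; have [[_ pd] _ _] := C; have [_] := posdef_det (pd z Uz).
by rewrite /detg /gc kundt_11 kundt_12 kundt_22.
Qed.

Lemma detg'_gt0 w : (phi @` U) w -> 0 < detg s' w.
Proof.
move=> Uw; have [_ [_ pd] _] := C; have [_] := posdef_det (pd w Uw).
by rewrite /detg /gc kundt_11 kundt_12 kundt_22.
Qed.

(** The error affects [Dtot] at p only through its first derivatives there; what remains is the
    chain rule for [phi]. *)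
Lemma Dtot_transport (f : jet R 2 -> R) (F : 'rV[R]_4 -> R) i :
  differentiable f (jetof 2 s p) -> differentiable f (jetof 2 s' (phi p)) ->
  (forall z, U z -> f (jetof 2 s z) = f (jetof 2 s' (phi z)) + F z) ->
  differentiable F p -> partial i F p = 0 ->
  Dtot i f (jetof 3 s p) = \sum_j Dtot j f (jetof 3 s' (phi p)) * jac phi i j p.
Proof.
move=> df df' Ef dF F0.
have dj' : differentiable (jetof 2 s') (phi p) := jetof_differentiable (km_s' K) 2 U'p.
have dfj : differentiable (f \o jetof 2 s') (phi p) := differentiable_comp dj' df'.
have dphi j : differentiable (fun w => phi w 0 j) p by apply: (km_phi K j [::]).
rewrite (Dtot_jetof _ (km_oU K) (km_s K) Up df) (partial_eq i (km_oU K) Ef Up).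
rewrite (@partialD _ ((f \o jetof 2 s') \o phi)) //; last first.
  by apply: differentiable_comp => //; exact: smooth_on_differentiable (km_phi K) Up.
rewrite F0 addr0 partial_comp //.
by apply: eq_bigr => j _; rewrite (Dtot_jetof _ (km_oU' K) (km_s' K) U'p df').
Qed.

Lemma I_transport i :
  [/\ Dtot i (@I1 R) (jetof 3 s p) = \sum_j Dtot j (@I1 R) (jetof 3 s' (phi p)) * jac phi i j p,
      Dtot i (@I2a R) (jetof 3 s p) = \sum_j Dtot j (@I2a R) (jetof 3 s' (phi p)) * jac phi i j p
    & Dtot i (@I2b R) (jetof 3 s p) = \sum_j Dtot j (@I2b R) (jetof 3 s' (phi p)) * jac phi i j p].
Proof.
have oU := km_oU K; have oU' := km_oU' K; have sU := km_s K; have sU' := km_s' K.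
have D0 : deth (jetof 2 s p) != 0.
  by rewrite (detg_jetof oU sU Up) lt0r_neq0 // detg_gt0.
have D0' : deth (jetof 2 s' (phi p)) != 0.
  by rewrite (detg_jetof oU' sU' U'p) lt0r_neq0 // detg'_gt0.
have sD := smooth_detg oU sU.
have dp0 : detg s p != 0 by rewrite lt0r_neq0 // detg_gt0.
have Q := kundt_eqs_image.
split.
- have [F nF EF] := normW_transform K Up Q.
  have [dF F0] := partial_negligible_quotient Up i nF sD dp0.
  apply: (Dtot_transport (F := fun z => F z / detg s z)) => //;
    [exact: I1_differentiable|exact: I1_differentiable|].
  move=> z Uz; rewrite (I1_jetof oU sU Uz) (I1_jetof oU' sU' (km_map K Uz)).
  apply: (quotient_transform 0 (detg_transform K Uz) _ (EF z Uz)).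
  by rewrite lt0r_neq0 // detg_gt0.
- have [F [sF fF] EF] := Hvv_transform K Up Q.
  apply: (Dtot_transport (F := F)) => //;
    [exact: I2a_differentiable|exact: I2a_differentiable| |exact: (sF [::])|exact: (fF 1%N [:: i])].
  by move=> z Uz; rewrite (I2a_jetof oU sU Uz) (I2a_jetof oU' sU' (km_map K Uz)) EF.
- have [F nF EF] := curlW_transform K Up Q.
  have [sF _] := nF.
  have sd := smooth_jdet K.
  (* With c = curlW s, this is c^2 - (c - F)^2, the error of the squared curl. *)
  pose F2 z := (curlW s z + curlW s z - F z) * F z.
  have nF2 : negligible U p F2.
    apply: (negligibleM K Up) nF; apply: smoothD => //; last exact: smoothN.
    by apply: smoothD => //; apply: smooth_curlW.
  have [dF F0] := partial_negligible_quotient Up i nF2 sD dp0.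
  apply: (Dtot_transport (F := fun z => F2 z / detg s z)) => //;
    [exact: I2b_differentiable|exact: I2b_differentiable|].
  move=> z Uz; rewrite (I2b_jetof oU sU Uz) (I2b_jetof oU' sU' (km_map K Uz)).
  apply: (quotient_transform 0 (detg_transform K Uz)).
    by rewrite lt0r_neq0 // detg_gt0.
  rewrite /F2 EF //; move: (curlW _ _) (jdet _ _) (F z) => *; ring.
Qed.

End Action.
End Transport.

(** * Invariance of the derivations *)

Section MetricDuality.
Context {R : realType}.
Implicit Types (y : 'rV[R]_6) (X Y w : 'rV[R]_4) (th : jet R 3).

Notation e i := (delta_mx 0 i : 'rV[R]_4).

Lemma row4P X Y : X 0 iu = Y 0 iu -> X 0 ix1 = Y 0 ix1 -> X 0 ix2 = Y 0 ix2 ->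
  X 0 iv = Y 0 iv -> X = Y.
Proof. by move=> *; apply/rowP; elim/ord4_ind. Qed.

Lemma kundt_delta_u y X : kundt y X (e iu) =
  (2 * y 0 cH * X 0 iu + X 0 iv + y 0 cW1 * X 0 ix1 + y 0 cW2 * X 0 ix2) / 2.
Proof. by rewrite /kundt !mxE /=; field. Qed.
Lemma kundt_delta_1 y X : kundt y X (e ix1) =
  y 0 cW1 * X 0 iu / 2 + y 0 ch11 * X 0 ix1 + y 0 ch12 * X 0 ix2.
Proof. by rewrite /kundt !mxE /=; field. Qed.
Lemma kundt_delta_2 y X : kundt y X (e ix2) =
  y 0 cW2 * X 0 iu / 2 + y 0 ch12 * X 0 ix1 + y 0 ch22 * X 0 ix2.
Proof. by rewrite /kundt !mxE /=; field. Qed.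
Lemma kundt_delta_v y X : kundt y X (e iv) = X 0 iu / 2.
Proof. by rewrite /kundt !mxE /=; field. Qed.

Lemma kundtE y X Y : kundt y X Y = \sum_i kundt y X (e i) * Y 0 i.
Proof.
rewrite sum4 kundt_delta_u kundt_delta_1 kundt_delta_2 kundt_delta_v /kundt; by field.
Qed.

(** Nondegeneracy, by a triangular scheme: d_v detects the u-component, d_(x^1) and d_(x^2) then
    give the x-components since det h > 0, and d_u gives the v-component. [kundt_surj] solves in the
    same order. *)
Lemma kundt_inj y X X' : posdef y -> (forall Y, kundt y X Y = kundt y X' Y) -> X = X'.
Proof.
move=> py H; have [h11 D0] := posdef_det py.
have Hu := H (e iu); have H1 := H (e ix1); have H2 := H (e ix2); have Hv := H (e iv).
rewrite !kundt_delta_u in Hu; rewrite !kundt_delta_1 in H1.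
rewrite !kundt_delta_2 in H2; rewrite !kundt_delta_v in Hv.
move: H1 H2 Hu Hv D0 h11 {H py}.
move: (y 0 cH) (y 0 cW1) (y 0 cW2) (y 0 ch11) (y 0 ch12) (y 0 ch22) => h w1 w2 a b c.
move=> H1 H2 Hu Hv D0 a0.
have Eu : X 0 iu = X' 0 iu by lra.
rewrite Eu in H1 H2 Hu.
have D0' : a * c - b ^+ 2 != 0 by rewrite lt0r_neq0.
have F1 : a * X 0 ix1 + b * X 0 ix2 = a * X' 0 ix1 + b * X' 0 ix2 by lra.
have F2 : b * X 0 ix1 + c * X 0 ix2 = b * X' 0 ix1 + c * X' 0 ix2 by lra.
have E1 : X 0 ix1 = X' 0 ix1.
  apply: (mulfI D0').
  transitivity (c * (a * X 0 ix1 + b * X 0 ix2) - b * (b * X 0 ix1 + c * X 0 ix2)); first by ring.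
  by rewrite F1 F2; ring.
have E2 : X 0 ix2 = X' 0 ix2.
  apply: (mulfI D0').
  transitivity (a * (b * X 0 ix1 + c * X 0 ix2) - b * (a * X 0 ix1 + b * X 0 ix2)); first by ring.
  by rewrite F1 F2; ring.
by apply: row4P => //; rewrite E1 E2 in Hu; lra.
Qed.

Lemma kundt_surj y w : posdef y -> exists X, forall Y, kundt y X Y = \sum_i w 0 i * Y 0 i.
Proof.
move=> py; have [_ D0] := posdef_det py.
pose D := y 0 ch11 * y 0 ch22 - y 0 ch12 ^+ 2.
have D0' : D != 0 by rewrite lt0r_neq0.
pose Xu := 2 * w 0 iv.
pose r1 := w 0 ix1 - y 0 cW1 * Xu / 2; pose r2 := w 0 ix2 - y 0 cW2 * Xu / 2.
pose X1 := (y 0 ch22 * r1 - y 0 ch12 * r2) / D.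
pose X2 := (y 0 ch11 * r2 - y 0 ch12 * r1) / D.
pose X := \row_i (if i == iu then Xu else if i == ix1 then X1 else if i == ix2 then X2
  else 2 * w 0 iu - 2 * y 0 cH * Xu - y 0 cW1 * X1 - y 0 cW2 * X2) : 'rV[R]_4.
exists X => Y; rewrite kundtE; apply: eq_bigr => i _; congr (_ * _).
elim/ord4_ind: i.
- by rewrite kundt_delta_u !mxE /=; field.
- by rewrite kundt_delta_1 !mxE /= /X1 /X2 /r1 /r2 /D; field.
- by rewrite kundt_delta_2 !mxE /= /X1 /X2 /r1 /r2 /D; field.
- by rewrite kundt_delta_v !mxE /= /Xu; field.
Qed.

Lemma form1E th a i : form1 th a 0 i =
  hd (@I1 R) th 0 i + a.1 * hd (@I2a R) th 0 i + a.2 * hd (@I2b R) th 0 i.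
Proof.
have M (x y z : 'rV[R]_4) (k l : R) : (x + k *: y + l *: z) 0 i = x 0 i + k * y 0 i + l * z 0 i.
  by rewrite !mxE.
exact: M.
Qed.

Lemma sum4_comb (x y z t : 'I_4 -> R) (k l : R) :
  \sum_j x j * t j + k * (\sum_j y j * t j) + l * (\sum_j z j * t j) =
  \sum_j (x j + k * y j + l * z j) * t j.
Proof. by rewrite !sum4; ring. Qed.

Lemma solve2 (j11 j12 j21 j22 x1 x2 : R) : j11 * j22 - j12 * j21 != 0 ->
  x1 * j21 + x2 * j22 = 0 -> x1 * j11 + x2 * j12 = 0 -> x1 = 0 /\ x2 = 0.
Proof.
move=> D0 E2 E1; split; apply: (mulIf D0); rewrite mul0r.
  transitivity (j22 * (x1 * j11 + x2 * j12) - j12 * (x1 * j21 + x2 * j22)); first by ring.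
  by rewrite E1 E2 !mulr0 subr0.
transitivity (j11 * (x1 * j21 + x2 * j22) - j21 * (x1 * j11 + x2 * j12)); first by ring.
by rewrite E1 E2 !mulr0 subr0.
Qed.

Lemma lin2 (x1 x2 y1 y2 : R) : x1 = 0 -> x2 = 0 -> x1 * y1 + x2 * y2 = 0.
Proof. by move=> -> ->; rewrite !mul0r addr0. Qed.

Lemma sum4_drop (x y : 'I_4 -> R) : y iu = 0 -> x iv = 0 ->
  \sum_j x j * y j = x ix1 * y ix1 + x ix2 * y ix2.
Proof. by move=> yu xv; rewrite sum4 yu xv mulr0 mul0r add0r addr0. Qed.

Lemma sharpP th w : posdef (jval th) ->
  forall Y, kundt (jval th) (sharp th w) Y = \sum_i w 0 i * Y 0 i.
Proof. by move=> py; apply: (xgetPex 0 (kundt_surj w py)). Qed.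

Lemma sharpE th w X : posdef (jval th) ->
  (forall Y, kundt (jval th) X Y = \sum_i w 0 i * Y 0 i) -> sharp th w = X.
Proof. by move=> py H; apply: (kundt_inj py) => Y; rewrite sharpP // H. Qed.

End MetricDuality.

Section Invariance.
Context {R : realType}.
Implicit Types (X Y w : 'rV[R]_4) (th : jet R 3).

Notation e i := (delta_mx 0 i : 'rV[R]_4).

Section Action.
Context (U : set 'rV[R]_4) (phi : 'rV[R]_4 -> 'rV[R]_4) (s s' : 'rV[R]_4 -> 'rV[R]_6).
Context (p : 'rV[R]_4) (G : pseudogroup U phi) (C : carries U phi s s') (Up : U p).
Context (E : forall n, Etilde (jetof n s p)).

Let K : kmap U (phi @` U) phi (jac phi) s s' := kmap_of_pseudogroup G C.
Let U'p : (phi @` U) (phi p) := km_map K Up.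

Notation th := (jetof 3 s p).
Notation th' := (jetof 3 s' (phi p)).
Notation L := ('d phi p).

Let Eth' : Etilde th' := Etilde_image G C Up E 3.
Let pd : posdef (jval th). Proof. by have [] := E 3. Qed.
Let pd' : posdef (jval th'). Proof. by have [] := Eth'. Qed.

Lemma kundt_L X Y : kundt (jval th') (L X) (L Y) = kundt (jval th) X Y.
Proof.
have [_ _ T] := C.
rewrite (jval_jetof (km_oU K) (km_s K) 3 Up) (jval_jetof (km_oU' K) (km_s' K) 3 U'p).
exact: (esym (T p Up X Y)).
Qed.

Lemma L_surj Y : exists X, L X = Y.
Proof.
have [psi [spsi psiK K']] := inverse_exists G C.
by exists ('d psi (phi p) Y); apply: (diff_inverse' K spsi psiK Y Up).
Qed.

Lemma jdet_neq0 : jac phi ix1 ix1 p * jac phi ix2 ix2 p - jac phi ix1 ix2 p * jac phi ix2 ix1 p != 0.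
Proof.
have [psi [spsi psiK K']] := inverse_exists G C.
by have [] := jac_block K spsi psiK Up.
Qed.

(** The covector [w] at p is the pullback of [w'] along [phi]. *)
Definition corresponding w w' := forall i, w 0 i = \sum_j w' 0 j * jac phi i j p.

Lemma corresponding_pair w w' X : corresponding w w' ->
  \sum_i w 0 i * X 0 i = \sum_j w' 0 j * (L X) 0 j.
Proof.
move=> H; transitivity (\sum_i \sum_j w' 0 j * (X 0 i * jac phi i j p)).
  apply: eq_bigr => i _; rewrite H mulr_suml; apply: eq_bigr => j _.
  by rewrite -mulrA [X 0 i * _]mulrC.
rewrite exchange_big; apply: eq_bigr => j _.
by rewrite (diff_jac _ _ (km_phi K) Up) mulr_sumr.
Qed.

(** An isometry carries duals of corresponding covectors to each other; surjectivity of the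
    differential allows testing against vectors [L X]. *)
Lemma sharp_L w w' : corresponding w w' -> sharp th' w' = L (sharp th w).
Proof.
move=> H; apply: (sharpE pd') => Y; have [X <-] := L_surj Y.
by rewrite kundt_L (sharpP _ pd) (corresponding_pair X H).
Qed.

Lemma hd_corresponding : [/\ corresponding (hd (@I1 R) th) (hd (@I1 R) th'),
  corresponding (hd (@I2a R) th) (hd (@I2a R) th') &
  corresponding (hd (@I2b R) th) (hd (@I2b R) th')].
Proof.
split=> i; have [T1 T2 T3] := I_transport G C Up E i; rewrite mxE.
- by rewrite T1; apply: eq_bigr => j _; rewrite mxE.
- by rewrite T2; apply: eq_bigr => j _; rewrite mxE.
- by rewrite T3; apply: eq_bigr => j _; rewrite mxE.
Qed.

Lemma form1_corresponding a : corresponding (form1 th a) (form1 th' a).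
Proof.
have [T1 T2 T3] := hd_corresponding => i.
apply: (etrans (form1E _ _ _)); rewrite (T1 i) (T2 i) (T3 i).
apply: (etrans (sum4_comb _ _ _ _ _ _)).
by apply: eq_bigr => j _; rewrite (form1E th').
Qed.

Lemma form1_v a : form1 th' a 0 iv = 0.
Proof.
have [E1 E2 E3] := Etilde_dvI Eth'.
by rewrite form1E !mxE E1 E2 E3 !mulr0 !addr0.
Qed.

Lemma a_solutions_eq : a_solutions th = a_solutions th'.
Proof.
have F i a : i != iu -> form1 th a 0 i =
    form1 th' a 0 ix1 * jac phi i ix1 p + form1 th' a 0 ix2 * jac phi i ix2 p.
  move=> ui; apply: (etrans (form1_corresponding a i)).
  exact: (sum4_drop (jac_u0 K Up ui) (form1_v a)).
apply/seteqP; split=> a [E1 E2].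
- have := etrans (esym (F ix1 a isT)) E1; have := etrans (esym (F ix2 a isT)) E2.
  exact: (solve2 jdet_neq0).
- split; [apply: (etrans (F ix1 a isT))|apply: (etrans (F ix2 a isT))].
    exact: (lin2 _ _ E1 E2).
  exact: (lin2 _ _ E1 E2).
Qed.

Lemma dom_nabla1_image : dom_nabla1 th -> dom_nabla1 th'.
Proof.
move=> [_ U1]; split; first exact: Eth'.
exact: (eq_ind _ (fun S : set (R * R) => exists! a, S a) U1 _ a_solutions_eq).
Qed.

Lemma nabla1_L : nabla1 th' = L (nabla1 th).
Proof.
(* [a12] depends on the solution set alone, so equality of the two sets suffices. *)
have EA : a12 th' = a12 th := f_equal (xget (0, 0)) (esym a_solutions_eq).
apply: (etrans (f_equal (fun a => sharp th' (form1 th' a)) EA)).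
exact: (sharp_L (form1_corresponding (a12 th))).
Qed.

Lemma nabla2_L : nabla2 th' = L (nabla2 th).
Proof. by have [_ T _] := hd_corresponding; exact: (sharp_L T). Qed.

Lemma nabla3_L : nabla3 th' = L (nabla3 th).
Proof. by have [_ _ T] := hd_corresponding; exact: (sharp_L T). Qed.

Lemma nabla4_solutions_L X : nabla4_solutions th' (L X) <-> nabla4_solutions th X.
Proof.
have E1 := f_equal (fun Y => kundt (jval th') Y (L X)) nabla1_L.
have E2 := f_equal (fun Y => kundt (jval th') Y (L X)) nabla2_L.
have E3 := f_equal (fun Y => kundt (jval th') Y (L X)) nabla3_L.
have {}E1 := etrans E1 (kundt_L _ _); have {}E2 := etrans E2 (kundt_L _ _).
have {}E3 := etrans E3 (kundt_L _ _); have E4 := kundt_L X X.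
split=> -[H1 H2 H3 H4]; split.
- exact: (etrans (esym E1) H1).
- exact: (etrans (esym E2) H2).
- exact: (etrans (esym E3) H3).
- exact: (etrans (esym E4) H4).
- exact: (etrans E1 H1).
- exact: (etrans E2 H2).
- exact: (etrans E3 H3).
- exact: (etrans E4 H4).
Qed.

(** Here the solution set is moved by the differential rather than preserved, and a choice by [xget]
    need not follow it; uniqueness of the solution makes it do so. *)
Lemma dom_nabla4_image : dom_nabla4 th -> dom_nabla4 th' /\ nabla4 th' = L (nabla4 th).
Proof.
move=> [D1 [X [SX uX]]].
have SX' : nabla4_solutions th' (L X) := (nabla4_solutions_L X).2 SX.
have uX' Y : nabla4_solutions th' Y -> L X = Y.
  have [Z <-] := L_surj Y => SZ; exact: (f_equal L (uX Z ((nabla4_solutions_L Z).1 SZ))).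
split; first by split; [exact: dom_nabla1_image|exists (L X); split].
have EX : X = nabla4 th := uX _ (xgetPex 0 (ex_intro _ X SX)).
have EX' : L X = nabla4 th' := uX' _ (xgetPex 0 (ex_intro _ (L X) SX')).
exact: (etrans (esym EX') (f_equal L EX)).
Qed.

Lemma derive_jet_image n X : 'D_X (fun z => jetof n s' (phi z)) p = hvec (L X) (jetof n.+1 s' (phi p)).
Proof.
have dphi : differentiable phi p := smooth_on_differentiable (km_phi K) Up.
have dj : differentiable (jetof n s') (phi p) := jetof_differentiable (km_s' K) n U'p.
rewrite -(derive_jetof (km_oU' K) (km_s' K) n _ U'p).
rewrite [LHS](deriveE _ (differentiable_comp dphi dj)) (diff_comp dphi dj) /=.
by rewrite deriveE.
Qed.

End Action.

(** Invariance at every jet order reduces to transport of base vectors: [phi] pushes the lift of X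
    to the lift of its image under the differential. *)
Lemma invariant_derivationI (V : set (jet R 3)) (X : jet R 3 -> 'rV[R]_4) :
  (forall (U : set 'rV[R]_4) (phi : 'rV[R]_4 -> 'rV[R]_4) (s s' : 'rV[R]_4 -> 'rV[R]_6)
      (p : 'rV[R]_4),
    pseudogroup U phi -> carries U phi s s' -> U p -> (forall k, Etilde (jetof k s p)) ->
    V (jetof 3 s p) ->
    V (jetof 3 s' (phi p)) /\ X (jetof 3 s' (phi p)) = 'd phi p (X (jetof 3 s p))) ->
  invariant_derivation V X.
Proof.
move=> H U phi s s' p G C Up E Vp; have [V' EX] := H U phi s s' p G C Up E Vp.
by split=> // k; rewrite EX; apply: (derive_jet_image G C Up).
Qed.

Lemma nabla1_invariant : invariant_derivation (@dom_nabla1 R) (@nabla1 R).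
Proof.
apply: invariant_derivationI => U phi s s' p G C Up E D.
by split; [exact: (dom_nabla1_image G C Up E)|exact: (nabla1_L G C Up E)].
Qed.

Lemma nabla2_invariant : invariant_derivation [set th : jet R 3 | Etilde th] (@nabla2 R).
Proof.
apply: invariant_derivationI => U phi s s' p G C Up E D.
by split; [exact: (Etilde_image G C Up E 3)|exact: (nabla2_L G C Up E)].
Qed.

Lemma nabla3_invariant : invariant_derivation [set th : jet R 3 | Etilde th] (@nabla3 R).
Proof.
apply: invariant_derivationI => U phi s s' p G C Up E D.
by split; [exact: (Etilde_image G C Up E 3)|exact: (nabla3_L G C Up E)].
Qed.

Lemma nabla4_invariant : invariant_derivation (@dom_nabla4 R) (@nabla4 R).
Proof.
apply: invariant_derivationI => U phi s s' p G C Up E; exact: (dom_nabla4_image G C Up E).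
Qed.

End Invariance.

(** * Independence *)

Section Independence.
Context {R : realType}.
Implicit Types (X Y Z : 'rV[R]_4) (th : jet R 3).

Notation e i := (delta_mx 0 i : 'rV[R]_4).

Lemma kundt_addl (y : 'rV[R]_6) X Y Z : kundt y (X + Y) Z = kundt y X Z + kundt y Y Z.
Proof. by rewrite /kundt !mxE; field. Qed.

Lemma kundt_scalel (y : 'rV[R]_6) (k : R) X Z : kundt y (k *: X) Z = k * kundt y X Z.
Proof. by rewrite /kundt !mxE; field. Qed.

Lemma kundt0l (y : 'rV[R]_6) Z : kundt y 0 Z = 0.
Proof. by rewrite -(scale0r (0 : 'rV[R]_4)) kundt_scalel mul0r. Qed.

Lemma kundt_comb4 (y : 'rV[R]_6) (k1 k2 k3 k4 : R) (X1 X2 X3 X4 : 'rV[R]_4) Z :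
  kundt y (k1 *: X1 + (k2 *: X2 + (k3 *: X3 + k4 *: X4))) Z =
  k1 * kundt y X1 Z + (k2 * kundt y X2 Z + (k3 * kundt y X3 Z + k4 * kundt y X4 Z)).
Proof. by rewrite !kundt_addl !kundt_scalel. Qed.

Definition minor2 (w2 w3 : 'rV[R]_4) : R :=
  w2 0 ix1 * w3 0 ix2 - w2 0 ix2 * w3 0 ix1.

Definition minor3 (w1 w2 w3 : 'rV[R]_4) : R :=
  w1 0 iu * minor2 w2 w3
  - w1 0 ix1 * (w2 0 iu * w3 0 ix2 - w2 0 ix2 * w3 0 iu)
  + w1 0 ix2 * (w2 0 iu * w3 0 ix1 - w2 0 ix1 * w3 0 iu).

Lemma cramer2 (a11 a12 a21 a22 b1 b2 : R) : a11 * a22 - a12 * a21 != 0 ->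
  exists! x : R * R, a11 * x.1 + a12 * x.2 = b1 /\ a21 * x.1 + a22 * x.2 = b2.
Proof.
move=> D0; exists ((b1 * a22 - a12 * b2) / (a11 * a22 - a12 * a21),
  (a11 * b2 - a21 * b1) / (a11 * a22 - a12 * a21)); split=> /=; first by split; field.
move=> [x1 x2] /= [<- <-]; congr (_, _); by field.
Qed.

Lemma a_solutions_unique th : minor2 (hd (@I2a R) th) (hd (@I2b R) th) != 0 ->
  exists! a, a_solutions th a.
Proof.
move=> D0.
have [|x [[E1 E2] U]] := @cramer2 (hd (@I2a R) th 0 ix1) (hd (@I2b R) th 0 ix1)
  (hd (@I2a R) th 0 ix2) (hd (@I2b R) th 0 ix2)
  (- hd (@I1 R) th 0 ix1) (- hd (@I1 R) th 0 ix2).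
  by move: D0; rewrite /minor2 [X in _ - X]mulrC.
have S a i : form1 th a 0 i = 0 <->
    hd (@I2a R) th 0 i * a.1 + hd (@I2b R) th 0 i * a.2 = - hd (@I1 R) th 0 i.
  rewrite form1E; move: (hd _ _ _ _) (hd _ _ _ _) (hd _ _ _ _) => h1 h2 h3.
  by split=> H; lra.
exists x; split; first by split; apply/S.
by move=> a [/S A1 /S A2]; apply: U.
Qed.

(** Cramer's rule, with the hypotheses in the unsimplified form left by pairing a linear relation
    with d_(x^1) and d_(x^2). *)
Lemma lin_indep2 (wa wb : 'rV[R]_4) (k2 k3 x1 x2 : R) : minor2 wa wb != 0 ->
  0 * x1 + (k2 * (wa 0 iu * 0 + wa 0 ix1 * 1 + wa 0 ix2 * 0)
    + (k3 * (wb 0 iu * 0 + wb 0 ix1 * 1 + wb 0 ix2 * 0) + 0 * x2)) = 0 ->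
  forall x3 x4,
  0 * x3 + (k2 * (wa 0 iu * 0 + wa 0 ix1 * 0 + wa 0 ix2 * 1)
    + (k3 * (wb 0 iu * 0 + wb 0 ix1 * 0 + wb 0 ix2 * 1) + 0 * x4)) = 0 ->
  k2 = 0 /\ k3 = 0.
Proof.
rewrite /minor2; move: (wa 0 iu) (wa 0 ix1) (wa 0 ix2) (wb 0 iu) (wb 0 ix1) (wb 0 ix2).
move=> a0 a1 a2 b0 b1 b2 D P1 x3 x4 P2.
have P1' : k2 * a1 + k3 * b1 = 0 by rewrite -[RHS]P1; ring.
have P2' : k2 * a2 + k3 * b2 = 0 by rewrite -[RHS]P2; ring.
split; apply: (mulIf D); rewrite mul0r.
  transitivity (b2 * (k2 * a1 + k3 * b1) - b1 * (k2 * a2 + k3 * b2)); first by ring.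
  by rewrite P1' P2' !mulr0 subr0.
transitivity (a1 * (k2 * a2 + k3 * b2) - a2 * (k2 * a1 + k3 * b1)); first by ring.
by rewrite P1' P2' !mulr0 subr0.
Qed.

Section Frame.
Context th (Eth : Etilde th).
Context (D2 : minor2 (hd (@I2a R) th) (hd (@I2b R) th) != 0).
Context (D3 : minor3 (hd (@I1 R) th) (hd (@I2a R) th) (hd (@I2b R) th) != 0).

Let y := jval th.
Let w := form1 th (a12 th).
Let wa := hd (@I2a R) th.
Let wb := hd (@I2b R) th.

Let pd : posdef y. Proof. by have [] := Eth. Qed.

Lemma dom_nabla1I : dom_nabla1 th.
Proof. by split=> //; exact: a_solutions_unique. Qed.

(** If the u-component vanished as well, dI_1 would be a combination of dI_2a and dI_2b in the
    columns u, x^1, x^2, against the nonzero 3 x 3 minor. *)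
Lemma form1_coords : [/\ w 0 ix1 = 0, w 0 ix2 = 0, w 0 iv = 0 & w 0 iu != 0].
Proof.
have [a [Sa _]] := a_solutions_unique D2.
have [E1 E2] : a_solutions th (a12 th) := xgetPex (0, 0) (ex_intro _ a Sa).
have [V1 V2 V3] := Etilde_dvI Eth.
split=> //; first by rewrite /w form1E !mxE V1 V2 V3 !mulr0 !addr0.
apply/negP => /eqP Eu; move: D3; apply/negP; rewrite negbK; apply/eqP.
move: E1 E2 Eu; rewrite /w !form1E /minor3 /minor2.
move: (hd (@I1 R) th 0 iu) (hd (@I1 R) th 0 ix1) (hd (@I1 R) th 0 ix2).
move: (hd (@I2a R) th 0 iu) (hd (@I2a R) th 0 ix1) (hd (@I2a R) th 0 ix2).
move: (hd (@I2b R) th 0 iu) (hd (@I2b R) th 0 ix1) (hd (@I2b R) th 0 ix2).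
move: (a12 th).1 (a12 th).2 => k l b0 b1 b2 a0 a1 a2 u0 u1 u2 E1 E2 E0.
have -> : u0 = - (k * a0) - l * b0 by lra.
have -> : u1 = - (k * a1) - l * b1 by lra.
have -> : u2 = - (k * a2) - l * b2 by lra.
ring.
Qed.

Lemma kundt_nabla1 X : kundt y (nabla1 th) X = w 0 iu * X 0 iu.
Proof.
have [E1 E2 Ev _] := form1_coords.
by rewrite (sharpP _ pd) sum4 -/w E1 E2 Ev !mul0r !addr0.
Qed.

Lemma kundt_nabla2 X : kundt y (nabla2 th) X =
  wa 0 iu * X 0 iu + wa 0 ix1 * X 0 ix1 + wa 0 ix2 * X 0 ix2.
Proof.
have [_ V _] := Etilde_dvI Eth; have {}V : wa 0 iv = 0 by rewrite mxE.
by rewrite (sharpP _ pd) sum4 -/wa V mul0r addr0.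
Qed.

Lemma kundt_nabla3 X : kundt y (nabla3 th) X =
  wb 0 iu * X 0 iu + wb 0 ix1 * X 0 ix1 + wb 0 ix2 * X 0 ix2.
Proof.
have [_ _ V] := Etilde_dvI Eth; have {}V : wb 0 iv = 0 by rewrite mxE.
by rewrite (sharpP _ pd) sum4 -/wb V mul0r addr0.
Qed.

Lemma kundt_square X : kundt y X X = X 0 iu * X 0 iv + X 0 iu * (y 0 cH * X 0 iu
    + y 0 cW1 * X 0 ix1 + y 0 cW2 * X 0 ix2)
  + y 0 ch11 * X 0 ix1 ^+ 2 + 2 * y 0 ch12 * X 0 ix1 * X 0 ix2 + y 0 ch22 * X 0 ix2 ^+ 2.
Proof. by rewrite /kundt; field. Qed.

(** The pairing with nabla_1 fixes the u-component as the inverse of [w 0 iu], those with nabla_2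
    and nabla_3 fix the x-components by Cramer's rule, and the null condition is then linear in the
    v-component with the nonzero u-component as coefficient. *)
Lemma nabla4_solutions_unique : exists! X, nabla4_solutions th X.
Proof.
have [_ _ _ w0] := form1_coords.
have [|x [[A1 A2] Ux]] := @cramer2 (wa 0 ix1) (wa 0 ix2) (wb 0 ix1) (wb 0 ix2)
  (- (wa 0 iu * (w 0 iu)^-1)) (- (wb 0 iu * (w 0 iu)^-1)); first exact: D2.
pose Xv := - (y 0 cH * (w 0 iu)^-1 + y 0 cW1 * x.1 + y 0 cW2 * x.2)
  - w 0 iu * (y 0 ch11 * x.1 ^+ 2 + 2 * y 0 ch12 * x.1 * x.2 + y 0 ch22 * x.2 ^+ 2).
pose X : 'rV[R]_4 := \row_i (if i == iu then (w 0 iu)^-1 else if i == ix1 then x.1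
  else if i == ix2 then x.2 else Xv).
have Xu : X 0 iu = (w 0 iu)^-1 by rewrite mxE.
have X1 : X 0 ix1 = x.1 by rewrite mxE.
have X2 : X 0 ix2 = x.2 by rewrite mxE.
have XvE : X 0 iv = Xv by rewrite mxE.
exists X; split.
- split.
  + by rewrite -/y kundt_nabla1 Xu mulfV.
  + by rewrite -/y kundt_nabla2 Xu X1 X2 -addrA A1 subrr.
  + by rewrite -/y kundt_nabla3 Xu X1 X2 -addrA A2 subrr.
  + by rewrite -/y kundt_square Xu X1 X2 XvE /Xv; field.
- move=> Y [H1 H2 H3 H4].
  rewrite -/y kundt_nabla1 in H1; rewrite -/y kundt_nabla2 in H2; rewrite -/y kundt_nabla3 in H3.
  rewrite -/y kundt_square in H4.
  have Yu : Y 0 iu = (w 0 iu)^-1 by apply: (mulfI w0); rewrite H1 mulfV.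
  have EY : x = (Y 0 ix1, Y 0 ix2).
    apply: Ux => /=; rewrite -Yu; split.
      by rewrite -[RHS]add0r -H2; ring.
    by rewrite -[RHS]add0r -H3; ring.
  have Y1 : Y 0 ix1 = x.1 by rewrite EY.
  have Y2 : Y 0 ix2 = x.2 by rewrite EY.
  have Yv : Y 0 iv = Xv.
    have wi0 : (w 0 iu)^-1 != 0 by rewrite invr_eq0.
    apply: (mulfI wi0); rewrite Yu Y1 Y2 in H4.
    by apply/eqP; rewrite -subr_eq0; apply/eqP; rewrite -[RHS]H4 /Xv; field.
  by apply: row4P; rewrite ?Xu ?X1 ?X2 ?XvE.
Qed.

Lemma dom_nabla4I : dom_nabla4 th.
Proof. by split; [exact: dom_nabla1I|exact: nabla4_solutions_unique]. Qed.

Lemma nabla_free : free [:: nabla1 th; nabla2 th; nabla3 th; nabla4 th].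
Proof.
have [E1 E2 Ev w0] := form1_coords.
have [X [SX _]] := nabla4_solutions_unique.
have [N1 N2 N3 N4] : nabla4_solutions th (nabla4 th) := xgetPex 0 (ex_intro _ X SX).
(* A form without dv has a dual without u-component, and pairing with nabla_1 sees the u-component
   alone. *)
have u_of Y : Y 0 iu = 2 * kundt y Y (e iv) by rewrite kundt_delta_v; field.
have ev i : (e iv : 'rV[R]_4) 0 i = (i == iv)%:R by rewrite mxE eqxx.
have n1u : nabla1 th 0 iu = 0 by rewrite u_of kundt_nabla1 ev !mulr0.
have n2u : nabla2 th 0 iu = 0 by rewrite u_of kundt_nabla2 !ev /= !mulr0 !addr0 mulr0.
have n3u : nabla3 th 0 iu = 0 by rewrite u_of kundt_nabla3 !ev /= !mulr0 !addr0 mulr0.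
apply/(@freeP _ _ _ [tuple nabla1 th; nabla2 th; nabla3 th; nabla4 th]) => k.

rewrite !big_ord_recl big_ord0 addr0 /=.
set k1 := k _; set k2 := k _; set k3 := k _; set k4 := k _ => H.
have P Z : k1 * kundt y (nabla1 th) Z + (k2 * kundt y (nabla2 th) Z
    + (k3 * kundt y (nabla3 th) Z + k4 * kundt y (nabla4 th) Z)) = 0.
  exact: (etrans (esym (kundt_comb4 _ _ _ _ _ _ _ _ _ _)) (etrans (f_equal (fun Y => kundt y Y Z) H) (kundt0l y Z))).
have k10 : k1 = 0.
  by have := P (nabla4 th); rewrite N1 N2 N3 N4 !mulr0 !addr0 mulr1.
have k40 : k4 = 0.
  have := P (nabla1 th); rewrite (kundtC y (nabla2 th)) (kundtC y (nabla3 th)) (kundtC y (nabla4 th)) N1.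
  by rewrite !kundt_nabla1 n1u n2u n3u !mulr0 !add0r mulr1.
have ed i j : (e i : 'rV[R]_4) 0 j = (j == i)%:R by rewrite mxE eqxx.
have Q1 := P (e ix1); have Q2 := P (e ix2).
rewrite k10 k40 kundt_nabla2 kundt_nabla3 !ed /= in Q1.
rewrite k10 k40 kundt_nabla2 kundt_nabla3 !ed /= in Q2.
have [Q2' Q3'] := lin_indep2 D2 Q1 Q2.
move=> i; have := (k10, Q2', Q3', k40); rewrite /k1 /k2 /k3 /k4.
case: i => [[|[|[|[|//]]]] lt_i] [[[A B] C] D].
- by rewrite -[RHS]A; congr k; apply/val_inj.
- by rewrite -[RHS]B; congr k; apply/val_inj.
- by rewrite -[RHS]C; congr k; apply/val_inj.
- by rewrite -[RHS]D; congr k; apply/val_inj.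
Qed.

End Frame.
End Independence.

(** * The Zariski open set *)

Section ZariskiOpen.
Context {R : realType}.
Implicit Types (th : jet R 3) (p : 'rV[R]_4) (y : 'rV[R]_6).

(** A product, so that a single polynomial expresses both conditions on each fiber. *)
Definition frame_minor th : R :=
  minor2 (hd (@I2a R) th) (hd (@I2b R) th)
  * minor3 (hd (@I1 R) th) (hd (@I2a R) th) (hd (@I2b R) th).

Definition frame_set : set (jet R 3) := [set th | Etilde th /\ frame_minor th != 0].

Section Fiber.
Context p y (py : posdef y).

Definition jet_fiber : set (jet R 3) := [set th | [/\ Etilde th, th.1 = p & jval th = y]].

(** The polynomial may vary with the fiber, so functions of (p, y), such as 1 / det h, count as
    constants. *)
Definition fiber_polynomial (f : jet R 3 -> R) : Prop :=
  exists P : mpoly.mpoly (6 * #|{: midx 3}|) R,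
    forall th, jet_fiber th -> mpoly.meval (mxvec th.2 0) P = f th.

Lemma fiber_polynomial_ext f g : (forall th, jet_fiber th -> f th = g th) ->
  fiber_polynomial f -> fiber_polynomial g.
Proof. by move=> E [P HP]; exists P => th fth; rewrite HP // E. Qed.

Lemma fiber_polynomialC (c : R) : fiber_polynomial (fun=> c).
Proof. by exists (mpoly.mpolyC _ c) => th _; rewrite mpoly.mevalC. Qed.

Lemma fiber_polynomialD f g : fiber_polynomial f -> fiber_polynomial g ->
  fiber_polynomial (fun th => f th + g th).
Proof.
by move=> [P HP] [Q HQ]; exists (P + Q) => th fth; rewrite mpoly.mevalD HP // HQ.
Qed.

Lemma fiber_polynomialM f g : fiber_polynomial f -> fiber_polynomial g ->
  fiber_polynomial (fun th => f th * g th).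
Proof.
by move=> [P HP] [Q HQ]; exists (P * Q) => th fth; rewrite mpoly.mevalM HP // HQ.
Qed.

Lemma fiber_polynomialN f : fiber_polynomial f -> fiber_polynomial (fun th => - f th).
Proof. by move=> [P HP]; exists (- P) => th fth; rewrite mpoly.mevalN HP. Qed.

Lemma fiber_polynomialX f : fiber_polynomial f -> fiber_polynomial (fun th => f th ^+ 2).
Proof. by move=> Ff; under eq_fun do rewrite expr2; apply: fiber_polynomialM. Qed.

Lemma fiber_polynomial_jcoord a l : fiber_polynomial (fun th => jcoord th a l).
Proof.
case: (leqP (size l) 3) => sl; last first.
  by apply: fiber_polynomial_ext (fiber_polynomialC 0) => th _; rewrite jcoord_oversize.
have [m pm] := word_sort sl.
exists (mpoly.mpolyX R (mpoly.mnm1 (mxvec_index a (enum_rank m)))) => th _.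
by rewrite mpoly.mevalXU mxvecE (jcoord_word _ _ pm).
Qed.

Lemma fiber_deth th : jet_fiber th -> deth th = y 0 ch11 * y 0 ch22 - y 0 ch12 ^+ 2.
Proof. by move=> [_ _ <-]; rewrite !mxE. Qed.

Ltac fiber_polynomial_tac := repeat first [ exact: fiber_polynomial_jcoord
  | exact: fiber_polynomialC | apply: fiber_polynomialD | apply: fiber_polynomialN
  | apply: fiber_polynomialX | apply: fiber_polynomialM ].

Let D0 : R := y 0 ch11 * y 0 ch22 - y 0 ch12 ^+ 2.

Let D0_neq0 : D0 != 0.
Proof. by have [_ /lt0r_neq0] := posdef_det py. Qed.

Lemma fiber_polynomial_hd i :
  [/\ fiber_polynomial (fun th => hd (@I1 R) th 0 i),
      fiber_polynomial (fun th => hd (@I2a R) th 0 i)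
    & fiber_polynomial (fun th => hd (@I2b R) th 0 i)].
Proof.
split.
- apply: (@fiber_polynomial_ext (fun th => (dI1num i th * D0 - I1num th * ddeth i th) * D0 ^- 2)).
    by move=> th fth; rewrite mxE Dtot_I1 fiber_deth.
  by rewrite /dI1num /I1num /ddeth; fiber_polynomial_tac.
- apply: fiber_polynomial_ext (fiber_polynomial_jcoord cH [:: i; iv; iv]) => th _.
  by rewrite mxE Dtot_I2a.
- apply: (@fiber_polynomial_ext (fun th =>
    (2 * I2bq th * dI2bq i th * D0 - I2bq th ^+ 2 * ddeth i th) * D0 ^- 2)).
    by move=> th fth; rewrite mxE Dtot_I2b fiber_deth.
  by rewrite /I2bq /dI2bq /ddeth; fiber_polynomial_tac.
Qed.

Lemma fiber_polynomial_minor2 (w2 w3 : jet R 3 -> 'rV[R]_4) :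
  (forall i, fiber_polynomial (fun th => w2 th 0 i)) ->
  (forall i, fiber_polynomial (fun th => w3 th 0 i)) ->
  fiber_polynomial (fun th => minor2 (w2 th) (w3 th)).
Proof.
move=> P2 P3; rewrite /minor2; repeat first [ exact: P2 | exact: P3
  | apply: fiber_polynomialD | apply: fiber_polynomialN | apply: fiber_polynomialM ].
Qed.

Lemma fiber_polynomial_minor3 (w1 w2 w3 : jet R 3 -> 'rV[R]_4) :
  (forall i, fiber_polynomial (fun th => w1 th 0 i)) ->
  (forall i, fiber_polynomial (fun th => w2 th 0 i)) ->
  (forall i, fiber_polynomial (fun th => w3 th 0 i)) ->
  fiber_polynomial (fun th => minor3 (w1 th) (w2 th) (w3 th)).
Proof.
move=> P1 P2 P3; rewrite /minor3 /minor2; repeat first [ exact: P1 | exact: P2 | exact: P3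
  | apply: fiber_polynomialD | apply: fiber_polynomialN | apply: fiber_polynomialM ].
Qed.

Lemma fiber_polynomial_frame_minor : fiber_polynomial frame_minor.
Proof.
have P1 i : fiber_polynomial (fun th => hd (@I1 R) th 0 i) by case: (fiber_polynomial_hd i).
have P2 i : fiber_polynomial (fun th => hd (@I2a R) th 0 i) by case: (fiber_polynomial_hd i).
have P3 i : fiber_polynomial (fun th => hd (@I2b R) th 0 i) by case: (fiber_polynomial_hd i).
exact: fiber_polynomialM (fiber_polynomial_minor2 P2 P3) (fiber_polynomial_minor3 P1 P2 P3).
Qed.

(* The jet variables equal to 1 in a jet where the minors do not vanish; those of
   positive order not listed are 0. *)
Definition generic_words : seq ('I_6 * seq 'I_4) :=
  [:: (cH, [:: ix1; iv; iv]); (cW1, [:: iv]); (cW1, [:: iu; iv]); (cW1, [:: ix2; iv]);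
      (cW1, [:: ix2; ix2; iv])].

Definition generic_word (a : 'I_6) (l : seq 'I_4) : bool :=
  has (fun q => (q.1 == a) && perm_eq q.2 l) generic_words.

Definition generic_value (a : 'I_6) (l : seq 'I_4) : R :=
  if nilp l then y 0 a else (generic_word a l)%:R.

Definition generic_jet : jet R 3 := (p, \matrix_(a, j) generic_value a (word (enum_val j))).

Lemma jcoord_generic a l : (size l <= 3)%N -> jcoord generic_jet a l = generic_value a l.
Proof.
move=> sl; rewrite /generic_jet (jcoord_mk _ (F := generic_value)) // => l1 l2 pl _.
rewrite /generic_value /nilp (perm_size pl); case: ifP => // _; congr (_%:R).
rewrite /generic_word; congr nat_of_bool; apply: eq_has => q /=.
by rewrite (permPr pl).
Qed.

(** Words listed for H contain v at most twice and those for W_1 at most once, one occurrence fewer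
    than the Kundt equations require, so the jet satisfies them. *)
Lemma generic_word_count a l : generic_word a l -> (count_mem iv l <= 1 + (a == cH))%N.
Proof.
move=> /hasP[q qin /andP[/eqP <- /permP E]]; rewrite -(E (pred1 iv)).
by move: qin; rewrite !inE => /or4P[|||/orP[]] /eqP ->.
Qed.

Lemma generic_jet_fiber : jet_fiber generic_jet.
Proof.
have V : jval generic_jet = y by apply/rowP => a; rewrite mxE jcoord_generic.
have Z c l : l != [::] -> (size l <= 3)%N -> generic_word c l = false ->
    jcoord generic_jet c l = 0.
  by move=> l0 sl gw; rewrite jcoord_generic // /generic_value gw; case: l l0 {sl gw}.
have ne (l l' : seq 'I_4) : l' != [::] -> l ++ l' != [::] by case: l.
split=> //; split; first by rewrite V.
- move=> c l cin sl; apply: Z => //; first exact: ne.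
  by move: cin; rewrite !inE => /or3P[]/eqP->.
- move=> c l cin sl; apply: Z => //; first exact: ne.
  apply/negP => /generic_word_count; rewrite count_cat /=.
  by move: cin; rewrite !inE => /orP[]/eqP-> /=; rewrite !addnS ltnS.
- move=> l sl; apply: Z => //; first exact: ne.
  by apply/negP => /generic_word_count; rewrite count_cat /= !addnS !ltnS.
Qed.

(** At this jet dI_2a = dx^1. Since the curl is 1, (W_1)_(x^2 x^2 v) = 1 makes dI_2b = (2 / D0)
    dx^2. Since (W_1)_v = 1, (W_1)_(uv) = 1 gives dI_1 the du-component 2 h_22 / D0. The minors are
    2 / D0 and 4 h_22 / D0^2. *)
Lemma generic_frame_minor : frame_minor generic_jet != 0.
Proof.
have E := jcoord_generic.
have Dg : deth generic_jet = D0 := fiber_deth generic_jet_fiber.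
have h22 : y 0 ch22 != 0.
  apply: lt0r_neq0; have /(_ 0 1) := py : posdef y; rewrite oner_eq0 orbT => /(_ isT).
  by rewrite !(expr1n, mulr1, mulr0, mul0r, expr0n, add0r).
have W1 : jcoord generic_jet cW1 [:: iv] = 1 by rewrite E.
have W2 : jcoord generic_jet cW2 [:: iv] = 0 by rewrite E.
have H22 : jcoord generic_jet ch22 [::] = y 0 ch22 by rewrite E.
have dh i : [/\ jcoord generic_jet ch11 [:: i] = 0, jcoord generic_jet ch12 [:: i] = 0
    & jcoord generic_jet ch22 [:: i] = 0] by rewrite !E.
have dW2 i : jcoord generic_jet cW2 [:: i; iv] = 0 by rewrite E.
have ddW2 i : jcoord generic_jet cW2 [:: i; ix1; iv] = 0 by rewrite E.
have dD i : ddeth i generic_jet = 0.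
  by have [d1 d2 d3] := dh i; rewrite /ddeth d1 d2 d3 !(mul0r, mulr0) addr0 subr0.
have q1 : I2bq generic_jet = 1.
  by rewrite /I2bq dW2 subr0 E.
have hI1 i : hd (@I1 R) generic_jet 0 i = 2 * jcoord generic_jet cW1 [:: i; iv] * y 0 ch22 / D0.
  have [d1 d2 d3] := dh i.
  rewrite mxE Dtot_I1 Dg // dD mulr0 subr0 /dI1num /= W1 W2 H22 d1 d2 d3 dW2.
  by move: (jcoord _ _ _) (jcoord _ _ _) (jcoord _ _ _) => *; field.
have hI2b i : hd (@I2b R) generic_jet 0 i = 2 * jcoord generic_jet cW1 [:: i; ix2; iv] / D0.
  rewrite mxE Dtot_I2b Dg // dD mulr0 subr0 q1 /dI2bq ddW2.
  by move: (jcoord _ _ _) => *; field.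
have hI2a i : hd (@I2a R) generic_jet 0 i = jcoord generic_jet cH [:: i; iv; iv].
  by rewrite mxE Dtot_I2a.
have [u0 [u1 u2]] : jcoord generic_jet cW1 [:: iu; iv] = 1 /\
  (jcoord generic_jet cW1 [:: ix1; iv] = 0 /\ jcoord generic_jet cW1 [:: ix2; iv] = 1).
  by rewrite !E.
have [a0 [a1 a2]] : jcoord generic_jet cH [:: iu; iv; iv] = 0 /\
  (jcoord generic_jet cH [:: ix1; iv; iv] = 1 /\ jcoord generic_jet cH [:: ix2; iv; iv] = 0).
  by rewrite !E.
have [b0 [b1 b2]] : jcoord generic_jet cW1 [:: iu; ix2; iv] = 0 /\
  (jcoord generic_jet cW1 [:: ix1; ix2; iv] = 0 /\ jcoord generic_jet cW1 [:: ix2; ix2; iv] = 1).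
  by rewrite !E.
rewrite /frame_minor /minor3 /minor2 !hI1 !hI2a !hI2b u0 u1 u2 a0 a1 a2 b0 b1 b2.
rewrite (_ : _ * _ = 8 * y 0 ch22 / D0 ^+ 3); last by field.
by rewrite mulf_neq0 ?invr_eq0 ?expf_neq0 // mulf_neq0 // pnatr_eq0.
Qed.

End Fiber.

Lemma frame_set_open : zariski_open frame_set.
Proof.
split; first by move=> th [].
move=> p y py /=; split.
  by exists (generic_jet p y); split; [split|]; [case: (generic_jet_fiber p py)
    |exact: generic_frame_minor|exact: generic_jet_fiber].
have [P HP] := fiber_polynomial_frame_minor p py.
exists [set P] => th fth; split.
  by move=> [_ nz]; exists P => //; rewrite HP.
by move=> [Q -> nz]; split; [case: fth|rewrite -HP].
Qed.

End ZariskiOpen.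

Theorem proposition18 (R : realType) :
  [/\ invariant_derivation (@dom_nabla1 R) (@nabla1 R),
      invariant_derivation [set th : jet R 3 | Etilde th] (@nabla2 R),
      invariant_derivation [set th : jet R 3 | Etilde th] (@nabla3 R),
      invariant_derivation (@dom_nabla4 R) (@nabla4 R)
    & exists2 V : set (jet R 3), zariski_open V &
        forall th, V th ->
          dom_nabla4 th /\
          free [:: nabla1 th; nabla2 th; nabla3 th; nabla4 th]].
Proof.
split; [exact: nabla1_invariant|exact: nabla2_invariant|exact: nabla3_invariant
  |exact: nabla4_invariant|].
exists frame_set; first exact: frame_set_open.
move=> th [Eth]; rewrite /frame_minor mulf_eq0 negb_or => /andP[D2 D3].
by split; [exact: dom_nabla4I|exact: nabla_free].
Qed.
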